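(* Let $d,k,m_0,N\in\mathbb{N}$ and $p\in(0,2]$, let $Q\subset\mathbb{C}^d$ be a complete circular domain centered at $0\in Q$, let $f(z)=\sum_{n=0}^{\infty}P_n(z)$ (homogeneous polynomial expansion) converge in $Q$, with $a=|f(0)|<1$ and $|f(z)|<1$ for all $z\in Q$, and let $\widehat{\omega}_{m_0}\in\mathcal{B}_{m_0}$, $\widehat{\omega}_k\in\mathcal{B}_k$. Let $R^{k,N}_{p,m_0}$ be the minimum root in $(0,1)$ of the equation $$2r^{kN}(1+r^{m_0})-p(1-r^{m_0})(1-r^k)=0.$$ Then $$|f(\widehat{\omega}_{m_0}(z))|^p+\sum_{n=N}^{\infty}|P_n(\widehat{\omega}_k(z))|\le 1$$ in the homothetic domain $(R^{k,N}_{p,m_0})\,Q$; that is, $|f(b\,\widehat{\omega}_{m_0}(h))|^p+\sum_{n=N}^{\infty}|P_n(b)|\,|\widehat{\omega}_k(h)|^n\le 1$ for every $b\in\mathbb{C}^d$ with $b\mathbb{D}\subset Q$ and every $h\in\mathbb{D}$ with $|h|<R^{k,N}_{p,m_0}$. Moreover, if $Q$ is convex, then $R^{k,N}_{p,m_0}$ is best possible.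
   Context: $\mathbb{D}=\{h\in\mathbb{C}:|h|<1\}$. $\mathcal{B}$ is the set of analytic functions $g$ on $\mathbb{D}$ with $\sup_{\mathbb{D}}|g|\le 1$. For $k\in\mathbb{N}=\{1,2,\dots\}$, $\mathcal{B}_k=\{\omega\in\mathcal{B}:\omega(0)=\omega'(0)=\cdots=\omega^{(k-1)}(0)=0,\ \omega^{(k)}(0)\ne 0\}$ (Schwarz functions). A domain $Q\subset\mathbb{C}^d$ is complete circular (centered at $0\in Q$) if $\lambda z\in Q$ whenever $z\in Q$, $|\lambda|\le 1$. A holomorphic $f$ on $Q$ expands as $f(z)=\sum_{n\ge 0}P_n(z)$ with $P_n(z)=\sum_{|\alpha|=n}A_\alpha z^\alpha$ a homogeneous polynomial of degree $n$ and $P_0=f(0)$. For $R>0$, $RQ=\{Rz:z\in Q\}$. Convention for Schwarz functions on $Q$: restrict to complex lines through the origin. A point of $Q$ is written $z=bh$ with $b\in\mathbb{C}^d$, $b\mathbb{D}:=\{bh:h\in\mathbb{D}\}\subset Q$ and $h\in\mathbb{D}$; then $f(\widehat{\omega}(z))$ means $f(b\,\widehat{\omega}(h))$ and $P_n(\widehat{\omega}(z))$ means $P_n(b\,\widehat{\omega}(h))=P_n(b)\,\widehat{\omega}(h)^n$. An inequality holds in $RQ$ if it holds for all such $b$ and all $|h|<R$. ''Best possible'' means: for every $R'$ with $R<R'\le 1$, where $R$ is the stated number, there exist a function $f$ satisfying the hypotheses on the given $Q$ and Schwarz functions in the stated classes for which the inequality does not hold in $R'Q$. (If $Q=\mathbb{C}^d$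 all $RQ$ coincide, so the sharpness assertion is understood for $Q\neq\mathbb{C}^d$.) *)

(* Defs.v *)
From HB Require Import structures.
From mathcomp Require Import all_boot all_order all_algebra.
From mathcomp Require Import all_classical all_reals all_analysis.
From mathcomp Require Export complex.

Set Implicit Arguments.
Unset Strict Implicit.
Unset Printing Implicit Defensive.

Import Order.TTheory GRing.Theory Num.Theory.
Import numFieldNormedType.Exports.

Local Open Scope classical_set_scope.
Local Open Scope ring_scope.

(* The cast makes the topology and the norm that every numFieldType carries
   available on R[i]. *)
Notation cplx R := (R[i]%C : numFieldType).

(* The real-valued modulus; on R[i] the ring_scope norm takes values in R[i]. *)
Notation modulus := (@Normc.normc _).

Definition unit_disc (R : realType) : set (cplx R) := [set h | modulus h < 1].

Definition analytic_on (R : realType) (U : set (cplx R))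
    (g : cplx R -> cplx R) : Prop :=
  forall h0, U h0 -> exists (c : nat -> cplx R) (r : R), 0 < r /\
    forall h, modulus (h - h0) < r ->
      [series c n * (h - h0) ^+ n]_n @ \oo --> g h.

Definition class_B (R : realType) (g : cplx R -> cplx R) : Prop :=
  analytic_on (@unit_disc R) g /\
  forall h, unit_disc h -> modulus (g h) <= 1.

Definition class_Bk (R : realType) (k : nat) (w : cplx R -> cplx R) : Prop :=
  [/\ class_B w,
      forall j, (j < k)%N -> derive1n j w 0 = 0
    & derive1n k w 0 <> 0].

Definition complete_circular_domain (R : realType) (d : nat)
    (Q : set 'rV[cplx R]_d) : Prop :=
  [/\ open Q, connected Q, Q 0
    & forall (l : cplx R) z, modulus l <= 1 -> Q z -> Q (l *: z)].

Definition holomorphic_on (R : realType) (d : nat) (Q : set 'rV[cplx R]_d)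
    (f : 'rV[cplx R]_d -> cplx R) : Prop :=
  forall z, Q z -> differentiable f z.

(* Every exponent of a multi-index of weight n is at most n, so the
   multi-indices of weight n are finite functions into 'I_n.+1. *)
Definition homogeneous_poly (R : realType) (d n : nat)
    (P : 'rV[cplx R]_d -> cplx R) : Prop :=
  exists A : {ffun 'I_d -> 'I_n.+1} -> cplx R, forall z,
    P z = \sum_(alpha : {ffun 'I_d -> 'I_n.+1}
                 | (\sum_(i < d) alpha i == n)%N)
            A alpha * \prod_(i < d) z 0 i ^+ alpha i.

Definition homogeneous_expansion (R : realType) (d : nat)
    (Q : set 'rV[cplx R]_d) (f : 'rV[cplx R]_d -> cplx R)
    (P : nat -> 'rV[cplx R]_d -> cplx R) : Prop :=
  (forall n, homogeneous_poly n (P n)) /\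
  forall z, Q z -> [series P n z]_n @ \oo --> f z.

Definition admissible (R : realType) (d : nat) (Q : set 'rV[cplx R]_d)
    (f : 'rV[cplx R]_d -> cplx R)
    (P : nat -> 'rV[cplx R]_d -> cplx R) : Prop :=
  [/\ holomorphic_on Q f, homogeneous_expansion Q f P, modulus (f 0) < 1
    & forall z, Q z -> modulus (f z) < 1].

(* The sum is taken in \bar R, so that divergence violates the inequality. *)
Definition bohr_ineq (R : realType) (d N : nat) (p : R)
    (f : 'rV[cplx R]_d -> cplx R) (P : nat -> 'rV[cplx R]_d -> cplx R)
    (w1 w2 : cplx R -> cplx R) (b : 'rV[cplx R]_d) (h : cplx R) : Prop :=
  ((modulus (f (w1 h *: b)) `^ p)%:E
   + \sum_(N <= n <oo) (modulus (P n b) * modulus (w2 h) ^+ n)%:E <= 1%:E)%E.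

(* Points of rho Q are described through the slices b D contained in Q. *)
Definition bohr_ineq_in (R : realType) (d N : nat) (p rho : R)
    (Q : set 'rV[cplx R]_d)
    (f : 'rV[cplx R]_d -> cplx R) (P : nat -> 'rV[cplx R]_d -> cplx R)
    (w1 w2 : cplx R -> cplx R) : Prop :=
  forall b : 'rV[cplx R]_d, (forall h, unit_disc h -> Q (h *: b)) ->
  forall h, unit_disc h -> modulus h < rho -> bohr_ineq N p f P w1 w2 b h.

Definition radius_root (R : realType) (k m0 N : nat) (p r : R) : Prop :=
  0 < r < 1 /\
  2 * r ^+ (k * N) * (1 + r ^+ m0) - p * (1 - r ^+ m0) * (1 - r ^+ k) = 0.

Definition min_radius_root (R : realType) (k m0 N : nat) (p r : R) : Prop :=
  radius_root k m0 N p r /\ forall s, radius_root k m0 N p s -> r <= s.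

(* Main.v *)
Require Import Defs.
From HB Require Import structures.
From mathcomp Require Import all_boot all_order all_algebra.
From mathcomp Require Import all_classical all_reals all_analysis.
From mathcomp Require Import ring lra.
From mathcomp Require cyclic separable cyclotomic.
Set Implicit Arguments.
Unset Strict Implicit.
Unset Printing Implicit Defensive.

Import Order.TTheory GRing.Theory Num.Theory.
Import numFieldNormedType.Exports.
Local Open Scope classical_set_scope.
Local Open Scope ring_scope.
Local Open Scope complex_scope.

(** The radius comes from a one-variable estimate on slices.  Fix [b] with
    [bD] inside [Q]: then [g h := f (h b)] is the power series
    [sum_n P_n(b) h^n], bounded by 1 on the unit disc.  With [a = |f 0|],
    [r = |h|] and [rho = r^m0], the Schwarz lemma gives [|w1 h| <= rho] and
    [|w2 h| <= r^k] ([schwarz_lemma]), the Schwarz-Pick inequality gives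
    [|g (w1 h)| <= x := (a + rho) / (1 + a rho)] ([schwarz_pick_growth]), and
    the coefficients satisfy [|P_n(b)| <= 1 - a^2] for [n >= 1]
    ([coefficient_bound]).  As [p <= 2], concavity gives
    [1 - x^p >= (p / 2) (1 - x^2)], while
    [1 - x^2 = (1 - a^2) (1 - rho^2) / (1 + a rho)^2] is at least
    [(1 - a^2) (1 - rho) / (1 + rho)].  The factor [1 - a^2] cancels and the
    inequality reduces to [2 r^(kN) (1 + rho) <= p (1 - rho) (1 - r^k)]
    ([bohr_real_inequality]).  The difference of the two sides increases with
    [r] and vanishes at the radius ([radius_poly_mono]), so the inequality holds
    exactly up to it.

    The complex analysis rests on one notion, [taylor2]: a function having a
    second-order expansion with cubic remainder at a point.  It is stable
    under product and inverse, power series have it, and it suffices for the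
    maximum modulus principle: where [|u|^2 + eps |h|^2] has a local maximum,
    averaging over the four points [h + i^j t] kills all mixed terms up to
    order two and leaves the positive contribution [eps t^2], which the
    remainder [O(t^3)] cannot compensate ([no_interior_max]).  Applied to the
    quotient [(g - c) / (h^n (1 - c^* g))], where [g = c + O(h^n)], this yields
    the Schwarz lemma, the Schwarz-Pick inequality and the bound on the [n]-th
    coefficient at once ([schwarz_pick]); for the latter, averaging [g] over
    the rotations by [n]-th roots of unity removes the coefficients of index
    strictly between 0 and [n].

    For sharpness, a point outside the convex set [Q] gives, through the gauge
    of [Q] and a finite-dimensional Hahn-Banach argument, a complex linear form
    [l] with [|l| < 1] on [Q] and [l b = 1] for some [b] with [bD] inside [Q]
    ([supporting_functional]).  The functions [f = (a + l) / (1 + a l)],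
    [w1 h = h^m0] and [w2 h = h^k] turn every estimate above into an equality
    up to terms that are negligible when [a] tends to 1: to first order in
    [1 - a], the inequality at [b] and [h = r] is the one defining the radius
    ([extremal_parameter], [extremal_real_inequality]). *)

(** * Complex moduli and series *)

Section Modulus.
Variable R : realType.
Implicit Types (x y z : cplx R) (a b : R).

Lemma normE z : `|z| = (modulus z)%:C.
Proof. by []. Qed.

Lemma modulus_ge0 z : 0 <= modulus z.
Proof. by case: z => a b; exact: sqrtr_ge0. Qed.

Lemma modulusM x y : modulus (x * y) = modulus x * modulus y.
Proof. exact: Normc.normcM. Qed.

Lemma modulus0 : modulus (0 : cplx R) = 0.
Proof. exact: Normc.normc0. Qed.

Lemma modulus1 : modulus (1 : cplx R) = 1.
Proof. exact: Normc.normc1. Qed.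

Lemma modulusV x : modulus x^-1 = (modulus x)^-1.
Proof. exact: Normc.normcV. Qed.

Lemma modulusX x n : modulus (x ^+ n) = modulus x ^+ n.
Proof.
elim: n => [|n IH]; first by rewrite !expr0 modulus1.
by rewrite !exprS modulusM IH.
Qed.

Lemma modulusN x : modulus (- x) = modulus x.
Proof. exact: (@normcN R x). Qed.

Lemma ler_modulusD x y : modulus (x + y) <= modulus x + modulus y.
Proof. exact: (@le_normcD R x y). Qed.

Lemma modulus_distC x y : modulus (x - y) = modulus (y - x).
Proof. by rewrite -modulusN opprB. Qed.

Lemma ler_subr_modulus x y : modulus x - modulus y <= modulus (x - y).
Proof. by rewrite lerBlDr (le_trans _ (ler_modulusD _ _))// subrK. Qed.

Lemma modulus_eq0 x : (modulus x == 0) = (x == 0).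
Proof.
by apply/eqP/eqP => [/Normc.eq0_normc|->]; rewrite ?modulus0.
Qed.

Lemma modulus_gt0 x : (0 < modulus x) = (x != 0).
Proof. by rewrite lt_def modulus_ge0 andbT modulus_eq0. Qed.

Lemma modulus_real a : modulus (a%:C : cplx R) = `|a|.
Proof. by rewrite /= expr0n /= addr0 sqrtr_sqr. Qed.

Lemma modulus_nat n : modulus (n%:R : cplx R) = n%:R.
Proof. by rewrite -(rmorph_nat (real_complex R)) modulus_real normr_nat. Qed.

Lemma sqr_modulus z : modulus z ^+ 2 = complex.Re z ^+ 2 + complex.Im z ^+ 2.
Proof. by case: z => a b /=; rewrite sqr_sqrtr// addr_ge0// sqr_ge0. Qed.

Lemma modulus_conj z : modulus z^*%C = modulus z.
Proof. by case: z => a b /=; rewrite sqrrN. Qed.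

Lemma mulr_conj z : z * z^*%C = (modulus z ^+ 2)%:C :> cplx R.
Proof. by rewrite -sqr_normc normE -rmorphXn. Qed.

Lemma normRe_le z : `|complex.Re z| <= modulus z.
Proof. by rewrite -lecR; exact: normc_ge_Re. Qed.

Lemma normIm_le z : `|complex.Im z| <= modulus z.
Proof.
case: z => a b /=; rewrite -[leLHS]sqrtr_sqr ler_wsqrtr//.
by rewrite lerDr sqr_ge0.
Qed.

Lemma modulus_leD_ReIm z : modulus z <= `|complex.Re z| + `|complex.Im z|.
Proof.
rewrite {1}[z](_ : _ = (complex.Re z)%:C + 'i * (complex.Im z)%:C); last first.
  exact: complexE.
rewrite (le_trans (ler_modulusD _ _))// modulusM !modulus_real.
by rewrite /= expr0n expr1n add0r sqrtr1 mul1r.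
Qed.

Lemma modulus_sum I (r : seq I) (P : pred I) (F : I -> cplx R) :
  modulus (\sum_(i <- r | P i) F i) <= \sum_(i <- r | P i) modulus (F i).
Proof.
elim/big_ind2 : _ => [|x a y b xa yb|//]; first by rewrite modulus0.
by rewrite (le_trans (ler_modulusD _ _))// lerD.
Qed.

(** Convergence of complex sequences in terms of the real-valued modulus: the
    norm of [R[i]] takes values in [R[i]], which makes comparisons with real
    bounds awkward. *)
Lemma cvg_modulusP (u : nat -> cplx R) l : u @ \oo --> l <->
  forall e : R, 0 < e -> exists n0, forall n, (n0 <= n)%N ->
    modulus (l - u n) < e.
Proof.
split => [/cvgrPdist_lt ul e e0|H].
  have /ul [n0 _ Hn] : 0 < e%:C :> cplx R by rewrite ltcR.
  by exists n0 => n n0n; have := Hn n n0n; rewrite normE ltcR.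
apply/cvgrPdist_lt => e e0.
have eR : e = (complex.Re e)%:C by rewrite RRe_real// gtr0_real.
have [|n0 Hn] := H (complex.Re e); first by rewrite eR ltcR in e0.
by exists n0 => // n /= n0n; rewrite normE eR ltcR; exact: Hn.
Qed.

End Modulus.

Section Summation.
Variable R : realType.
Implicit Types (u : nat -> cplx R) (s : cplx R) (M : R).

Lemma modulus_cvg_le u s M : u @ \oo --> s ->
  (forall n, modulus (u n) <= M) -> modulus s <= M.
Proof.
move=> /cvg_modulusP us uM; apply/ler_addgt0Pr => e e0.
have [n0 /(_ n0 (leqnn _)) H] := us e e0.
rewrite -[s](subrK (u n0)) (le_trans (ler_modulusD _ _))// addrC lerD// ltW//.
Qed.

(** The series of real and imaginary parts converge absolutely over the reals,
    so completeness of [R] is all that is used. *)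
Lemma absolutely_summable u M :
  (forall n, \sum_(0 <= i < n) modulus (u i) <= M) ->
  exists s, series u @ \oo --> s.
Proof.
move=> uM.
have partial (f : cplx R -> R) : (forall z, `|f z| <= modulus z) ->
    cvgn (series (fun i => f (u i))).
  move=> fle; apply: normed_cvg; apply: nondecreasing_is_cvgn.
    apply/nondecreasing_seqP => n; rewrite /series [leRHS]big_nat_recr//=.
    by rewrite lerDl normr_ge0.
  exists M => _ [n _ <-]; rewrite (le_trans _ (uM n))//.
  by rewrite /series/= ler_sum.
have /cvgrPdist_lt re := partial _ (@normRe_le R).
have /cvgrPdist_lt im := partial _ (@normIm_le R).
set a := lim _ in re; set b := lim _ in im.
exists ((a +i* b)%C : cplx R); apply/cvg_modulusP => e e0.
have e20 : 0 < e / 2 by rewrite divr_gt0.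
have [n1 _ re1] := re _ e20; have [n2 _ im1] := im _ e20.
exists (maxn n1 n2) => n; rewrite geq_max => /andP[n1n n2n].
apply: le_lt_trans (modulus_leD_ReIm _) _.
have -> : series u n = (series (fun i => complex.Re (u i)) n +i*
     series (fun i => complex.Im (u i)) n)%C.
  rewrite /series/=; elim: n {n1n n2n} => [|n IH]; first by rewrite !big_nil.
  by rewrite !big_nat_recr//= IH; case: (u n).
by rewrite /= [ltRHS]splitr ltrD//; [exact: re1|exact: im1].
Qed.

End Summation.

(** * Power series: absolute convergence and recentering *)

Section PowerSeries.
Variable R : realType.
Implicit Types (c : nat -> cplx R) (F : cplx R -> cplx R) (x z h s t : cplx R).

Lemma geometric_sum (q : R) n :
  (1 - q) * (\sum_(0 <= i < n) q ^+ i) = 1 - q ^+ n.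
Proof.
elim: n => [|n IH]; first by rewrite big_geq// expr0 subrr mulr0.
by rewrite big_nat_recr//= mulrDr IH exprS; ring.
Qed.

Lemma geometric_sum_le (q : R) n : 0 <= q < 1 ->
  \sum_(0 <= i < n) q ^+ i <= (1 - q)^-1.
Proof.
move=> /andP[q0 q1]; have q1' : 0 < 1 - q by rewrite subr_gt0.
rewrite -(ler_pM2l q1') geometric_sum divff ?gt_eqF// lerBlDr lerDl.
exact: exprn_ge0.
Qed.

(** The terms of the series at [t] are bounded, so inside the circle of radius
    [|t|] the series is dominated by a geometric one. *)
Lemma pseries_absolutely c t s (r : R) :
  series (fun n => c n * t ^+ n) @ \oo --> s -> 0 <= r < modulus t ->
  exists M : R, forall n, \sum_(0 <= i < n) modulus (c i) * r ^+ i <= M.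
Proof.
move=> cs /andP[r0 rt]; have t0 : 0 < modulus t := le_lt_trans r0 rt.
have [B B0 cB] : exists2 B : R, 0 <= B &
    forall n, modulus (c n) * modulus t ^+ n <= B.
  have /cvg_seq_bounded/pinfty_ex_gt0[B B0 SB] :
      cvgn (series (fun n => c n * t ^+ n)) by apply/cvg_ex; exists s.
  have BE : B = (complex.Re B)%:C by rewrite RRe_real// gtr0_real.
  have {}SB n : modulus (series (fun n => c n * t ^+ n) n) <= complex.Re B.
    by move: (SB n I) => /=; rewrite BE lecR.
  exists (complex.Re B + complex.Re B).
    by move: B0; rewrite BE ltcR => B0; rewrite addr_ge0// ltW.
  move=> n; rewrite -modulusX -modulusM.
  rewrite -[c n * _](seriesSB (fun n => c n * t ^+ n)).
  by rewrite (le_trans (ler_modulusD _ _))// modulusN lerD.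
exists (B * (1 - r / modulus t)^-1) => n.
have q1 : 0 <= r / modulus t < 1.
  by rewrite divr_ge0 ?modulus_ge0//= ltr_pdivrMr// mul1r.
apply: le_trans (ler_wpM2l B0 (geometric_sum_le n q1)).
rewrite big_distrr/=; apply: ler_sum => i _.
rewrite expr_div_n mulrA mulrAC ler_wpM2r ?exprn_ge0//.
by rewrite ler_pdivlMr ?exprn_gt0.
Qed.

(** The remainder of the binomial expansion of [(x + z)^n] at order [J] is the
    sum of the terms of index at least [J]; since [|z| <= d], each of these
    gains a factor [(|z| / d)^J] over the corresponding term of [(|x| + d)^n].
    Being a multiple of [(|x| + d)^n], the bound can be summed against the
    coefficients of a power series without counting powers of [n]. *)
Lemma binomial_tail x z (d : R) n J : 0 < d -> modulus z <= d ->
  modulus ((x + z) ^+ n - \sum_(0 <= j < J) x ^+ (n - j) * z ^+ j *+ 'C(n, j))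
  <= (modulus z / d) ^+ J * (modulus x + d) ^+ n.
Proof.
move=> d0 zd; have zd0 : 0 <= modulus z / d.
  by rewrite divr_ge0 ?modulus_ge0// ltW.
have zd1 : modulus z / d <= 1 by rewrite ler_pdivrMr// mul1r.
set t := fun j => x ^+ (n - j) * z ^+ j *+ 'C(n, j).
have -> : (x + z) ^+ n = \sum_(0 <= j < n.+1) t j.
  by rewrite big_mkord exprDn.
have t0 j : (n < j)%N -> t j = 0 by move=> nj; rewrite /t bin_small// mulr0n.
have -> : \sum_(0 <= j < n.+1) t j - \sum_(0 <= j < J) t j =
    \sum_(J <= j < n.+1) t j.
  have [nJ|Jn] := leqP n.+1 J.
    rewrite [in RHS]big_geq// (big_cat_nat (n := n.+1) (p := J))//=.
    have -> : \sum_(n.+1 <= j < J) t j = 0.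
      by rewrite big_nat_cond big1// => j; rewrite andbT => /andP[/t0].
    by rewrite addr0 subrr.
  rewrite (big_cat_nat (n := J) (p := n.+1))//=; last exact: ltnW.
  by rewrite addrAC subrr add0r.
apply: le_trans (modulus_sum _ _ _) _.
rewrite exprDn big_distrr/= -(big_mkord xpredT (fun j =>
  (modulus z / d) ^+ J * (modulus x ^+ (n - j) * d ^+ j *+ 'C(n, j)))).
have tj j : (J <= j)%N -> modulus (t j) <=
    (modulus z / d) ^+ J * (modulus x ^+ (n - j) * d ^+ j *+ 'C(n, j)).
  move=> Jj; rewrite /t normcMn modulusM !modulusX.
  have -> : modulus z ^+ j = (modulus z / d) ^+ j * d ^+ j.
    by rewrite expr_div_n divfK// expf_neq0// gt_eqF.
  rewrite mulrCA -[leLHS]mulrnAr ler_wpM2r//; last exact: ler_wiXn2l.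
  by rewrite mulrn_wge0// mulr_ge0 ?exprn_ge0 ?modulus_ge0// ltW.
have [nJ|Jn] := leqP n.+1 J.
  rewrite big_geq//; apply: sumr_ge0 => j _.
  by rewrite mulr_ge0 ?exprn_ge0// mulrn_wge0// mulr_ge0 ?exprn_ge0 ?modulus_ge0// ltW.
rewrite [leRHS](big_cat_nat (n := J))//= ?(ltnW Jn)//.
rewrite -[leLHS]add0r lerD//.
  apply: sumr_ge0 => j _.
  by rewrite mulr_ge0 ?exprn_ge0// mulrn_wge0// mulr_ge0 ?exprn_ge0 ?modulus_ge0// ltW.
rewrite big_nat_cond [leRHS]big_nat_cond; apply: ler_sum => j.
by rewrite andbT => /andP[Jj _]; exact: tj.
Qed.

End PowerSeries.

Section Recentering.
Variable R : realType.
Implicit Types (c : nat -> cplx R) (F : cplx R -> cplx R) (x z h s t : cplx R).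

Lemma eq_cvg_series (u v : nat -> cplx R) s : u =1 v ->
  series u @ \oo --> s -> series v @ \oo --> s.
Proof. by move=> /funext ->. Qed.

Lemma cvg_series_finite (u : nat -> cplx R) n0 :
  (forall n, (n0 <= n)%N -> u n = 0) -> series u @ \oo --> \sum_(0 <= i < n0) u i.
Proof.
move=> u0; apply: cvg_near_cst; exists n0 => // n /= n0n.
have tail : \sum_(n0 <= i < n) u i = 0.
  by rewrite big_nat_cond big1// => i; rewrite andbT => /andP[/u0].
by rewrite /series/= (big_cat_nat (n := n0))//= tail addr0.
Qed.

Lemma cvg_sum_nat (u : nat -> nat -> cplx R) (l : nat -> cplx R) J :
  (forall j, u j @ \oo --> l j) ->
  (fun n => \sum_(0 <= j < J) u j n) @ \oo --> \sum_(0 <= j < J) l j.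
Proof.
move=> ul; elim: J => [|J IH].
  rewrite big_geq//; under eq_fun do rewrite big_geq//.
  exact: cvg_cst.
have -> : \sum_(0 <= j < J.+1) l j = \sum_(0 <= j < J) l j + l J.
  by rewrite big_nat_recr.
rewrite [X in X @ _ --> _](_ : _ = (fun n => \sum_(0 <= j < J) u j n) \+ u J).
  exact (cvgD IH (ul J)).
by apply/funext => n; rewrite big_nat_recr.
Qed.

Lemma cvg_seriesB (u v : nat -> cplx R) s t :
  series u @ \oo --> s -> series v @ \oo --> t ->
  series (fun n => u n - v n) @ \oo --> s - t.
Proof.
move=> us vt; rewrite [X in X @ _ --> _](_ : _ = series u - series v).
  exact (cvgB us vt).
by apply/funext => n; rewrite fctE /series/= -sumrB.
Qed.

(** Summing [binomial_tail] against the coefficients shows that a power series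
    can be expanded around any interior point [x], with a remainder of order
    [J] for every [J]. *)
Lemma recenter c x (d M : R) : 0 < d ->
  (forall n, \sum_(0 <= i < n) modulus (c i) * (modulus x + d) ^+ i <= M) ->
  exists a : nat -> cplx R,
    (forall j, series (fun n => c n * (x ^+ (n - j) *+ 'C(n, j))) @ \oo --> a j)
    /\ forall J z s, modulus z <= d ->
       series (fun n => c n * (x + z) ^+ n) @ \oo --> s ->
       modulus (s - \sum_(0 <= j < J) a j * z ^+ j) <= M * (modulus z / d) ^+ J.
Proof.
move=> d0 cM; have xd0 : 0 <= modulus x + d by rewrite addr_ge0 ?modulus_ge0// ltW.
have /choice [a aE] j : exists s : cplx R,
    series (fun n => c n * (x ^+ (n - j) *+ 'C(n, j))) @ \oo --> s.
  apply: (@absolutely_summable _ _ (M * (d ^+ j)^-1)) => n.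
  apply: le_trans (ler_wpM2r _ (cM n)); last by rewrite invr_ge0 exprn_ge0// ltW.
  rewrite big_distrl/=; apply: ler_sum => i _.
  rewrite modulusM -mulrA ler_wpM2l ?modulus_ge0// ler_pdivlMr ?exprn_gt0//.
  rewrite normcMn modulusX exprDn.
  have [ij|ji] := ltnP i j.
    rewrite bin_small// mulr0n mul0r; apply: sumr_ge0 => k _.
    by rewrite mulrn_wge0// mulr_ge0 ?exprn_ge0 ?modulus_ge0// ltW.
  have ji' : (j < i.+1)%N by [].
  rewrite (bigD1 (Ordinal ji'))//= -mulrnAl lerDl; apply: sumr_ge0 => k _.
  by rewrite mulrn_wge0// mulr_ge0 ?exprn_ge0 ?modulus_ge0// ltW.
exists a; split => // J z s zd cs.
pose T n := \sum_(0 <= j < J) x ^+ (n - j) * z ^+ j *+ 'C(n, j).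
have cT : series (fun n => c n * T n) @ \oo --> \sum_(0 <= j < J) a j * z ^+ j.
  rewrite [X in X @ _ --> _](_ : _ = fun n => \sum_(0 <= j < J)
      series (fun n => c n * (x ^+ (n - j) *+ 'C(n, j))) n * z ^+ j).
    by apply: cvg_sum_nat => j; apply: cvgMl; exact: aE.
  apply/funext => n; rewrite /series /T /=.
  under eq_bigr do rewrite big_distrr/=.
  rewrite exchange_big/=; apply: eq_bigr => j _; rewrite big_distrl/=.
  by apply: eq_bigr => i _; rewrite -mulrA -mulrnAl.
apply: (@modulus_cvg_le _ (series (fun n => c n * ((x + z) ^+ n - T n)))).
  by apply: eq_cvg_series (cvg_seriesB cs cT) => n; rewrite mulrBr.
move=> n; rewrite /series/=; apply: le_trans (modulus_sum _ _ _) _.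
have zd0 : 0 <= (modulus z / d) ^+ J.
  by rewrite exprn_ge0// divr_ge0 ?modulus_ge0// ltW.
apply: le_trans (ler_wpM2r zd0 (cM n)); rewrite big_distrl/=.
apply: ler_sum => i _; rewrite modulusM -mulrA ler_wpM2l ?modulus_ge0//.
by rewrite mulrC; exact: binomial_tail.
Qed.

Lemma pseries_recenter c F (r : R) x :
  (forall h, modulus h < r ->
     series (fun n => c n * h ^+ n) @ \oo --> F h) -> modulus x < r ->
  exists (a : nat -> cplx R) (d M : R), [/\ 0 < d, 0 <= M,
    (forall j, series (fun n => c n * (x ^+ (n - j) *+ 'C(n, j))) @ \oo --> a j)
    & forall J z, modulus z <= d ->
    modulus (F (x + z) - \sum_(0 <= j < J) a j * z ^+ j) <= M * modulus z ^+ J / d ^+ J].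
Proof.
move=> cF xr.
(* With a third of the distance to the circle, [|x| + d] stays below
   [|x| + 2 d = |t|], a radius at which the series still converges. *)
pose d := (r - modulus x) / 3.
have d0 : 0 < d by rewrite divr_gt0// subr_gt0.
have x0 := modulus_ge0 x.
pose t := ((modulus x + d + d)%:C : cplx R).
have tE : modulus t = modulus x + d + d.
  by rewrite modulus_real ger0_norm// !addr_ge0// ltW.
have rE : r = modulus x + 3 * d.
  by rewrite /d mulrC divfK// addrC subrK.
have tr : modulus t < r by rewrite tE rE; lra.
have xdt : 0 <= modulus x + d < modulus t by rewrite tE; lra.
have [M cM] := pseries_absolutely (cF t tr) xdt.
have [a [aE aF]] := recenter d0 cM; exists a, d, M; split => //.
  by have := cM 0%N; rewrite big_geq.
move=> J z zd; rewrite -mulrA -expr_div_n; apply: aF => //; apply: cF.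
by rewrite (le_lt_trans (ler_modulusD _ _))// rE; lra.
Qed.

Lemma cvg_series_shift (u : nat -> cplx R) s :
  series u @ \oo --> s -> series (fun n => u n.+1) @ \oo --> s - u 0%N.
Proof.
move=> us; rewrite [X in X @ _ --> _](_ : _ = fun n => series u n.+1 - u 0%N).
  apply: (@cvgB _ _ _ _ _ (fun n => series u n.+1) (cst (u 0%N))).
    by move: us; rewrite -cvg_shiftS.
  exact (cvg_cst _).
apply/funext => n; rewrite /series/= [in RHS]big_nat_recl//=.
by rewrite addrAC subrr add0r.
Qed.

Lemma cvg_pseries_at0 c : series (fun n => c n * 0 ^+ n) @ \oo --> c 0%N.
Proof.
have := @cvg_series_finite (fun n => c n * 0 ^+ n) 1%N.
rewrite big_nat1 expr0 mulr1; apply => -[//|n] _.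
by rewrite /= expr0n mulr0.
Qed.

Lemma pseries_at0 c s : series (fun n => c n * 0 ^+ n) @ \oo --> s -> s = c 0%N.
Proof.
by move=> cs; apply: (cvg_unique _ cs (@cvg_pseries_at0 c)); exact: norm_hausdorff.
Qed.

(** The coefficient of order one in the expansion around [h] is the
    term-by-term derivative, and the remainder of order two makes the
    difference quotient converge to it. *)
Lemma pseries_derive1 c F (r : R) :
  (forall h, modulus h < r ->
     series (fun n => c n * h ^+ n) @ \oo --> F h) ->
  forall h, modulus h < r ->
     series (fun n => (n.+1%:R * c n.+1) * h ^+ n) @ \oo --> derive1 F h.
Proof.
move=> cF x xr; have [a [d [M [d0 M0 aE aF]]]] := pseries_recenter cF xr.
have -> : derive1 F x = a 1%N.
  have a0 : a 0%N = F x.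
    apply: (cvg_unique _ (aE 0%N)); first exact: norm_hausdorff.
    by apply: eq_cvg_series (cF _ xr) => m; rewrite bin0 subn0.
  apply: cvg_lim; first exact: norm_hausdorff.
  apply/cvgrPdist_le => e e0.
  have eE : e = (complex.Re e)%:C by rewrite RRe_real// gtr0_real.
  have {e0} e0 : 0 < complex.Re e by rewrite eE ltcR in e0.
  pose del := Num.min d (complex.Re e * d ^+ 2 / (M + 1)).
  have del0 : 0 < del.
    by rewrite lt_min d0 divr_gt0 ?mulr_gt0 ?exprn_gt0// ltr_wpDl.
  apply/nbhs_ballP; exists del%:C; first by rewrite /= ltcR.
  move=> z; rewrite -ball_normE /= sub0r normrN normE ltcR lt_min => /andP[zd ze] z0.
  have := aF 2 z (ltW zd); rewrite 2?big_nat_recr//= big_geq// add0r expr0 mulr1.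
  rewrite a0 expr1 => H.
  rewrite normE eE lecR -[_ *: _]/(_ * _).
  rewrite (_ : a 1%N - _ = - (z^-1 * (F (x + z) - (F x + a 1%N * z)))); last first.
    by rewrite (addrC z x); field.
  have zp : 0 < modulus z by rewrite modulus_gt0.
  rewrite modulusN modulusM modulusV mulrC ler_pdivrMr//.
  apply: le_trans H _; rewrite ler_pdivrMr ?exprn_gt0//.
  have /ltW := ze; rewrite ler_pdivlMr ?ltr_wpDl// => ze'.
  have := ler_wpM2l (ltW zp) ze'; have := sqr_ge0 (modulus z); nra.
have := cvg_series_shift (aE 1%N); rewrite bin0n mulr0n mulr0 subr0.
apply: eq_cvg_series => m.
by rewrite bin1 subn1/= -mulr_natl mulrA (mulrC (c _)).
Qed.

(** The vanishing of derivatives at 0 in the definition of Schwarz functions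
    thus becomes the vanishing of coefficients. *)
Lemma pseries_derive1n c F (r : R) n :
  (forall h, modulus h < r ->
     series (fun n => c n * h ^+ n) @ \oo --> F h) -> 0 < r ->
  derive1n n F 0 = n`!%:R * c n.
Proof.
move=> cF r0.
suff : exists e : nat -> cplx R, e 0%N = n`!%:R * c n /\
    forall h, modulus h < r -> series (fun m => e m * h ^+ m) @ \oo --> derive1n n F h.
  move=> [e [<- eF]]; apply: (@pseries_at0 e); apply: eF.
  by rewrite modulus0.
suff [e [eE eF]] : exists e : nat -> cplx R,
    (forall m, e m = ((n + m) ^_ n)%:R * c (n + m)%N) /\
    forall h, modulus h < r -> series (fun m => e m * h ^+ m) @ \oo --> derive1n n F h.
  by exists e; split => //; rewrite eE addn0 ffactnn.
elim: n => [|n [e [eE eF]]].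
  exists c; split => [m|]; last exact: cF.
  by rewrite ffactn0 mul1r.
exists (fun m => m.+1%:R * e m.+1); split; last exact: pseries_derive1.
move=> m; rewrite eE mulrA addnS -natrM addSn ffactnSr.
by rewrite subSn ?leq_addr// addKn mulnC.
Qed.

End Recentering.

(** * Functions with a second-order Taylor expansion *)

Section Taylor.
Variable R : realType.
Implicit Types (c : nat -> cplx R) (F u v e : cplx R -> cplx R) (x z h s t : cplx R).

Definition bounded_near0 e : Prop := exists d K : R, [/\ 0 < d, 0 <= K &
  forall z, modulus z < d -> modulus (e z) <= K].

(** The remainder [e] is only controlled near 0, and it is quantified over as
    a function so that the expansion can be manipulated as an identity valid
    for every [z]. *)
Definition taylor2 u x : Prop := exists (a b : cplx R) e,
  bounded_near0 e /\ forall z, u (x + z) = u x + a * z + b * z ^+ 2 + e z * z ^+ 3.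

Lemma bounded_near0_cst s : bounded_near0 (fun=> s).
Proof. by exists 1, (modulus s); split => //; exact: modulus_ge0. Qed.

Lemma bounded_near0_id : bounded_near0 id.
Proof. by exists 1, 1; split => // z /ltW. Qed.

Lemma bounded_near0D u v : bounded_near0 u -> bounded_near0 v ->
  bounded_near0 (fun z => u z + v z).
Proof.
move=> [d [K [d0 K0 uK]]] [d' [K' [d'0 K'0 vK]]].
exists (Num.min d d'), (K + K'); split; [by rewrite lt_min d0| exact: addr_ge0|].
move=> z; rewrite lt_min => /andP[zd zd'].
by rewrite (le_trans (ler_modulusD _ _))// lerD ?uK ?vK.
Qed.

Lemma bounded_near0M u v : bounded_near0 u -> bounded_near0 v ->
  bounded_near0 (fun z => u z * v z).
Proof.
move=> [d [K [d0 K0 uK]]] [d' [K' [d'0 K'0 vK]]].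
exists (Num.min d d'), (K * K'); split; [by rewrite lt_min d0| exact: mulr_ge0|].
move=> z; rewrite lt_min => /andP[zd zd'].
by rewrite modulusM ler_pM ?modulus_ge0 ?uK ?vK.
Qed.

Lemma bounded_near0X u n : bounded_near0 u -> bounded_near0 (fun z => u z ^+ n).
Proof.
move=> bu; elim: n => [|n IH].
  by under eq_fun do rewrite expr0; exact: bounded_near0_cst.
by under eq_fun do rewrite exprS; exact: bounded_near0M.
Qed.

Lemma bounded_near0N u : bounded_near0 u -> bounded_near0 (fun z => - u z).
Proof.
by move=> [d [K [d0 K0 uK]]]; exists d, K; split => // z; rewrite modulusN; exact: uK.
Qed.

(** Outside a neighbourhood of 0 the remainder can be redefined as the
    quotient that makes the expansion exact. *)
Lemma taylor2_near u x (a b : cplx R) e (d : R) : bounded_near0 e -> 0 < d ->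
  (forall z, modulus z < d -> u (x + z) = u x + a * z + b * z ^+ 2 + e z * z ^+ 3) ->
  taylor2 u x.
Proof.
move=> [d' [K [d'0 K0 eK]]] d0 ue.
exists a, b, (fun z => (u (x + z) - (u x + a * z + b * z ^+ 2)) / z ^+ 3); split.
  exists (Num.min d d'), K; split => //; first by rewrite lt_min d0.
  move=> z; rewrite lt_min => /andP[zd zd'].
  rewrite ue// [X in X / _]addrC addrA addNr add0r.
  have [->|z0] := eqVneq z 0; first by rewrite expr0n mulr0 mul0r modulus0.
  by rewrite mulfK ?expf_neq0// eK.
move=> z; have [->|z0] := eqVneq z 0.
  by rewrite addr0 !expr0n !mulr0 !addr0.
by rewrite divfK ?expf_neq0// [RHS]addrC subrK.
Qed.

Lemma taylor2_eq_near u v x (d : R) : 0 < d -> taylor2 u x ->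
  (forall z, modulus z < d -> u (x + z) = v (x + z)) -> taylor2 v x.
Proof.
move=> d0 [a [b [e [be ue]]]] uv; apply: (taylor2_near (a := a) (b := b) be d0).
move=> z zd; rewrite -uv// ue; do 3 congr (_ + _).
by have := uv 0; rewrite addr0 modulus0; exact.
Qed.

Lemma taylor2_cst s x : taylor2 (fun=> s) x.
Proof.
exists 0, 0, (fun=> 0); split; first exact: bounded_near0_cst.
by move=> z; rewrite !mul0r !addr0.
Qed.

Lemma taylor2_id x : taylor2 id x.
Proof.
exists 1, 0, (fun=> 0); split; first exact: bounded_near0_cst.
by move=> z; rewrite !mul0r !addr0 mul1r.
Qed.

Lemma taylor2B u v x : taylor2 u x -> taylor2 v x ->
  taylor2 (fun h => u h - v h) x.
Proof.
move=> [a [b [e [be ue]]]] [a' [b' [e' [be' ve]]]].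
exists (a - a'), (b - b'), (fun z => e z - e' z); split.
  by apply: bounded_near0D => //; exact: bounded_near0N.
by move=> z; rewrite ue ve; ring.
Qed.

Lemma taylor2M u v x : taylor2 u x -> taylor2 v x ->
  taylor2 (fun h => u h * v h) x.
Proof.
move=> [a [b [e [be ue]]]] [a' [b' [e' [be' ve]]]].
exists (a * v x + u x * a'), (b * v x + a * a' + u x * b').
exists (fun z => e z * v x + u x * e' z + (a * b' + b * a') +
   (a * e' z + b * b' + e z * a') * z + (b * e' z + e z * b') * z ^+ 2 +
   e z * e' z * z ^+ 3); split; last by move=> z; rewrite ue ve; ring.
by repeat first [assumption | exact: bounded_near0_cst | exact: bounded_near0_id
  | apply: bounded_near0D | apply: bounded_near0M | apply: bounded_near0X].
Qed.

Lemma taylor2_lipschitz u x : taylor2 u x -> exists d L : R, [/\ 0 < d, 0 < L &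
  forall z, modulus z < d -> modulus (u (x + z) - u x) <= L * modulus z].
Proof.
move=> [a [b [e [be ue]]]].
have [d [K [d0 K0 H]]] : bounded_near0 (fun z => a + b * z + e z * z ^+ 2).
  by repeat first [assumption | exact: bounded_near0_cst | exact: bounded_near0_id
    | apply: bounded_near0D | apply: bounded_near0M | apply: bounded_near0X].
exists d, (K + 1); split => //; first by rewrite ltr_wpDl.
move=> z zd; rewrite ue (_ : _ - _ = (a + b * z + e z * z ^+ 2) * z); last by ring.
by rewrite modulusM ler_wpM2r ?modulus_ge0// (le_trans (H z zd))// lerDl.
Qed.

(** The coefficients of the inverse are those of the formal inverse series;
    the remainder is a polynomial expression divided by [u], which stays
    bounded because [|u|] remains above half of its value at [x]. *)
Lemma taylor2V u x : u x != 0 -> taylor2 u x -> taylor2 (fun h => (u h)^-1) x.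
Proof.
move=> u0 tu; have [d [L [d0 L0 uL]]] := taylor2_lipschitz tu.
move: tu => [a [b [e [be ue]]]].
set m := modulus (u x); have m0 : 0 < m by rewrite modulus_gt0.
pose d' := Num.min d (m / 2 / L).
have d'0 : 0 < d' by rewrite lt_min d0 !divr_gt0.
have low z : modulus z < d' -> m / 2 <= modulus (u (x + z)).
  rewrite lt_min ltr_pdivlMr// => /andP[zd /ltW zm].
  have := uL z zd; rewrite modulus_distC => H.
  have := ler_subr_modulus (u x) (u x - u (x + z)).
  by rewrite subKr -/m; lra.
pose a' := - a / u x ^+ 2; pose b' := a ^+ 2 / u x ^+ 3 - b / u x ^+ 2.
apply: (@taylor2_near _ x a' b' (fun z => - (e z * (u x)^-1 + (a * b' + b * a') +
    (b * b' + e z * a') * z + e z * b' * z ^+ 2) * (u (x + z))^-1) _ _ d'0).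
  apply: bounded_near0M; last first.
    exists d', (m / 2)^-1; split => //; first by rewrite invr_ge0 divr_ge0// ltW.
    move=> z zd; rewrite modulusV lef_pV2 ?low//; rewrite posrE ?divr_gt0//.
    by rewrite (lt_le_trans _ (low z zd))// divr_gt0.
  apply: bounded_near0N.
  by repeat first [assumption | exact: bounded_near0_cst | exact: bounded_near0_id
  | apply: bounded_near0D | apply: bounded_near0M | apply: bounded_near0X].
move=> z zd; have : u (x + z) != 0.
  by rewrite -modulus_gt0 (lt_le_trans _ (low z zd))// divr_gt0.
by rewrite /a' /b' ue => uz0; field; rewrite uz0.
Qed.

Lemma taylor2X u x n : taylor2 u x -> taylor2 (fun h => u h ^+ n) x.
Proof.
move=> tu; elim: n => [|n IH].
  by under eq_fun do rewrite expr0; exact: taylor2_cst.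
by under eq_fun do rewrite exprS; exact: taylor2M.
Qed.

Lemma taylor2_pseries c F (r : R) x :
  (forall h, modulus h < r ->
     series (fun n => c n * h ^+ n) @ \oo --> F h) -> modulus x < r ->
  taylor2 F x.
Proof.
move=> cF xr; have [a [d [M [d0 M0 aE aF]]]] := pseries_recenter cF xr.
have a0 : F x = a 0%N.
  have := aF 1%N 0; rewrite big_nat1 addr0 modulus0 expr0 mulr1 expr1 mulr0 mul0r.
  move=> /(_ (ltW d0)) H; apply/eqP; rewrite -subr_eq0 -modulus_eq0.
  by rewrite eq_le H modulus_ge0.
pose e z := (F (x + z) - (F x + a 1%N * z + a 2%N * z ^+ 2)) / z ^+ 3.
apply: (@taylor2_near F x (a 1%N) (a 2%N) e d _ d0).
  exists d, (M / d ^+ 3); split => //; first by rewrite divr_ge0// exprn_ge0// ltW.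
  move=> z zd; rewrite /e; have [->|z0] := eqVneq z 0.
    by rewrite !expr0n /= invr0 mulr0 modulus0 divr_ge0// exprn_ge0// ltW.
  have := aF 3 z (ltW zd); rewrite 3?big_nat_recr//= big_geq// add0r expr0 mulr1.
  rewrite expr1 -a0 modulusM modulusV modulusX => H.
  by rewrite ler_pdivrMr ?exprn_gt0 ?modulus_gt0// mulrAC.
move=> z zd; rewrite /e; have [->|z0] := eqVneq z 0.
  by rewrite addr0 !expr0n !mulr0 !addr0.
by rewrite divfK ?expf_neq0// [RHS]addrC subrK.
Qed.

(** Stated for the real-valued modulus because it feeds an extreme value
    argument. *)
Lemma taylor2_cvg_modulus u x : taylor2 u x ->
  {for x, continuous (fun h : cplx R => modulus (u h))}.
Proof.
move=> /taylor2_lipschitz[d [L [d0 L0 uL]]].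
rewrite /prop_for /continuous_at; have FF : Filter (nbhs (x : cplx R)) by apply: nbhs_filter.
apply/(@cvgrPdist_le _ _ _ (nbhs (x : cplx R)) FF) => e e0.
have del0 : 0 < Num.min d (e / L) by rewrite lt_min d0 divr_gt0.
apply/nbhs_ballP; exists (Num.min d (e / L))%:C; first by rewrite /= ltcR.
move=> h; rewrite -ball_normE /= normE ltcR modulus_distC lt_min => /andP[hd he].
have {uL} := uL _ hd; rewrite (addrC x) subrK => uL.
have {}uL : modulus (u h - u x) <= e.
  by rewrite (le_trans uL)// mulrC -ler_pdivlMr// ltW.
rewrite ler_norml lerBrDl lerBlDr; apply/andP; split.
  have := ler_subr_modulus (u h) (u x); lra.
have := ler_subr_modulus (u x) (u h); rewrite modulus_distC; lra.
Qed.

End Taylor.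

(** * The maximum modulus principle *)

Section MaximumModulus.
Variable R : realType.
Implicit Types (u : cplx R -> cplx R) (x z h : cplx R) (s M : R).

Lemma continuous_real_complex : continuous (fun a : R => a%:C : cplx R).
Proof.
move=> a; apply/(@cvgrPdist_lt _ _ _ (nbhs a)) => e e0.
have eE : e = (complex.Re e)%:C by rewrite RRe_real// gtr0_real.
have {}e0 : 0 < complex.Re e by rewrite eE ltcR in e0.
apply/nbhs_ballP; exists (complex.Re e) => //= b.
by rewrite -ball_normE /= eE -rmorphB normE modulus_real ltcR.
Qed.

(** The disc is the continuous image of a closed bounded subset of the real
    plane. *)
Lemma compact_closed_disc s : compact [set h : cplx R | modulus h <= s].
Proof.
have [s0|s0] := ltP s 0.
  rewrite (_ : mkset _ = set0); first exact: compact0.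
  by apply/seteqP; split => h //= /le_lt_trans/(_ s0); rewrite ltNge modulus_ge0.
pose K := [set p : R * R | p.1 ^+ 2 + p.2 ^+ 2 <= s ^+ 2].
pose g (p : R * R) : cplx R := p.1%:C + 'i * p.2%:C.
have sqr_cvg (f : R * R -> R) : continuous f -> continuous (fun p => f p ^+ 2).
  by move=> cf p; under eq_fun do rewrite expr2; apply: cvgM; exact: cf.
have fst_cont : continuous (fun p : R * R => p.1) by move=> p; exact: cvg_fst.
have snd_cont : continuous (fun p : R * R => p.2) by move=> p; exact: cvg_snd.
have cK : compact K.
  apply: (@subclosed_compact _ _ (`[-s, s] `*` `[-s, s])).
  - rewrite (_ : K = (fun p : R * R => p.1 ^+ 2 + p.2 ^+ 2) @^-1` [set x | x <= s ^+ 2])//.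
    apply: closed_comp; last exact: closed_le.
    by move=> p _; apply: cvgD; apply: sqr_cvg.
  - exact (compact_setX (@segment_compact _ _ _) (@segment_compact _ _ _)).
  - move=> [a b]; rewrite /K /= !in_itv/= -!ler_norml => abs.
    by split; rewrite -(ler_pXn2r (n := 2)) ?nnegrE// real_normK ?num_real//;
      apply: le_trans abs; rewrite ?lerDl ?lerDr sqr_ge0.
have -> : [set h : cplx R | modulus h <= s] = g @` K.
  apply/seteqP; split => [h /= hs|_ [p Kp <-]].
    exists (complex.Re h, complex.Im h); last by rewrite /g/= -complexE.
    by rewrite /K/= -sqr_modulus ler_pXn2r// nnegrE modulus_ge0.
  suff : modulus (g p) ^+ 2 <= s ^+ 2 by rewrite ler_pXn2r// nnegrE modulus_ge0.
  rewrite sqr_modulus; have -> : g p = (p.1 +i* p.2)%C by rewrite /g [RHS]complexE.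
  exact: Kp.
apply: continuous_compact cK; apply: continuous_subspaceT => p.
apply: cvgD; first exact: (continuous_comp (fst_cont p) (@continuous_real_complex _)).
apply: cvgM; first exact: cvg_cst.
exact: (continuous_comp (snd_cont p) (@continuous_real_complex _)).
Qed.

(** Orthogonality of [1], [i^j] and [i^(2j)] over the four powers of [i]: a
    discrete Parseval identity, exact for polynomials of degree two. *)
Lemma four_point_sum (P : cplx R -> R) (a b c : cplx R) (t : R) :
  (forall z, P z = modulus (a + b * z + c * z ^+ 2) ^+ 2) ->
  P t%:C + P (- t%:C) + P ('i * t%:C) + P (- ('i * t%:C)) =
  4 * (modulus a ^+ 2 + modulus b ^+ 2 * t ^+ 2 + modulus c ^+ 2 * t ^+ 4).
Proof.
move=> PE; rewrite !PE !sqr_modulus {PE}.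
case: a b c => [a1 a2] [b1 b2] [c1 c2].
by rewrite !expr2 /=; simpc => /=; ring.
Qed.

Lemma sqr_modulusD_ge (a e : cplx R) (L K : R) :
  modulus a <= L -> modulus e <= K ->
  modulus a ^+ 2 - 2 * L * K <= modulus (a + e) ^+ 2.
Proof.
move=> aL eK; have := ler_subr_modulus a (- e); rewrite modulusN opprK.
move: (modulus_ge0 a) (modulus_ge0 e) (modulus_ge0 (a + e)) aL eK.
move: (modulus a) (modulus e) (modulus (a + e)) => A E S A0 E0 S0 AL EK AES.
have AEK : A * E <= L * K by rewrite ler_pM.
have AE0 : 0 <= A * E by rewrite mulr_ge0.
have -> : A ^+ 2 - 2 * L * K = A ^+ 2 - 2 * (L * K) by ring.
have [AE|EA] := lerP E A.
  have : (A - E) ^+ 2 <= S ^+ 2 by rewrite ler_pXn2r// nnegrE// subr_ge0.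
  have -> : (A - E) ^+ 2 = A ^+ 2 - 2 * (A * E) + E ^+ 2 by ring.
  by have := sqr_ge0 E; lra.
have : A ^+ 2 <= A * E by rewrite expr2 ler_wpM2l// ltW.
by have := sqr_ge0 S; lra.
Qed.

(** The term [eps |h|^2] makes the function strictly subharmonic.  If [x] were
    a maximum over a small disc, summing over [x + i^j t] would give, by
    [four_point_sum], [4 eps t^2 <= 8 L K t^3] where [K] bounds the cubic
    remainder and [L] the quadratic part, which fails for small [t]. *)
Lemma no_interior_max u x (eps d : R) : taylor2 u x -> 0 < eps -> 0 < d ->
  exists2 z, modulus z < d & modulus (u x) ^+ 2 + eps * modulus x ^+ 2 <
    modulus (u (x + z)) ^+ 2 + eps * modulus (x + z) ^+ 2.
Proof.
move=> [a [b [e [[d' [K [d'0 K0 eK]]] ue]]]] eps0 d0.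
apply: contrapT => /forall2NP H.
have {}H z : modulus z < d -> modulus (u (x + z)) ^+ 2 + eps * modulus (x + z) ^+ 2
    <= modulus (u x) ^+ 2 + eps * modulus x ^+ 2.
  by move=> zd; rewrite leNgt; apply/negP => hz; have [] := H z.
(* [L] bounds the quadratic part for [t <= 1]; the last term of the minimum
   makes [2 L K t < eps], contradicting the sum over the four points. *)
pose L := modulus (u x) + modulus a + modulus b.
have L0 : 0 <= L by rewrite !addr_ge0 ?modulus_ge0.
pose t := Num.min (Num.min d d') (Num.min 1 (eps / (2 * L * K + 1))) / 2.
have LK0 : 0 <= 2 * L * K by rewrite !mulr_ge0.
have m0 : 0 < Num.min (Num.min d d') (Num.min 1 (eps / (2 * L * K + 1))).
  by rewrite !lt_min d0 d'0 ltr01 divr_gt0// ltr_wpDl.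
have t0 : 0 < t by rewrite divr_gt0.
have : t < Num.min (Num.min d d') (Num.min 1 (eps / (2 * L * K + 1))).
  by rewrite /t; lra.
rewrite !lt_min -andbA => /and4P[td td' t1].
rewrite ltr_pdivlMr ?ltr_wpDl// => teps.
have low z : modulus z = t ->
    modulus (u x + a * z + b * z ^+ 2) ^+ 2 - 2 * L * (K * t ^+ 3)
    <= modulus (u (x + z)) ^+ 2.
  move=> zt; rewrite ue; apply: sqr_modulusD_ge.
    rewrite (le_trans (ler_modulusD _ _))// lerD//.
      rewrite (le_trans (ler_modulusD _ _))// lerD// modulusM zt.
      by rewrite ler_piMr ?modulus_ge0// ltW.
    by rewrite modulusM modulusX zt ler_piMr ?modulus_ge0// exprn_ile1 ?ltW.
  rewrite modulusM modulusX zt ler_wpM2r//; first by rewrite exprn_ge0// ltW.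
  by apply: eK; rewrite zt.
have mt1 : modulus (t%:C : cplx R) = t by rewrite modulus_real gtr0_norm.
have mt2 : modulus ('i * t%:C : cplx R) = t.
  by rewrite modulusM mt1 /= expr0n expr1n add0r sqrtr1 mul1r.
have mt3 : modulus (- t%:C : cplx R) = t by rewrite modulusN.
have mt4 : modulus (- ('i * t%:C) : cplx R) = t by rewrite modulusN.
have := @four_point_sum _ (u x) a b t (fun=> erefl).
have xP z : modulus (x + z) ^+ 2 = modulus (x + 1 * z + 0 * z ^+ 2) ^+ 2.
  by rewrite mul1r mul0r addr0.
have := four_point_sum t xP; rewrite modulus0 modulus1.
move: (low _ mt1) (low _ mt2) (low _ mt3) (low _ mt4).
have Hd z : modulus z = t -> modulus z < d by move=> ->.
move: (H _ (Hd _ mt1)) (H _ (Hd _ mt2)) (H _ (Hd _ mt3)) (H _ (Hd _ mt4)).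
move=> H1 H2 H3 H4 l1 l2 l3 l4 s1 s2.
have : 4 * eps * t ^+ 2 <= 8 * L * (K * t ^+ 3).
  have : 0 <= modulus a ^+ 2 * t ^+ 2 by rewrite mulr_ge0// sqr_ge0.
  have : 0 <= modulus b ^+ 2 * t ^+ 4 by rewrite mulr_ge0 ?sqr_ge0// exprn_ge0// ltW.
  have := congr1 (fun y => eps * y) s1.
  lra.
have t20 : 0 < t ^+ 2 by rewrite exprn_gt0.
suff : t ^+ 2 * (2 * L * K * t) < t ^+ 2 * eps by nra.
by rewrite ltr_pM2l//; lra.
Qed.

End MaximumModulus.

Section SchwarzPick.
Variable R : realType.
Implicit Types (g u v : cplx R -> cplx R) (x z h : cplx R) (s M : R).

(** By compactness [|u|^2 + eps |h|^2] attains its maximum on the disc, by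
    [no_interior_max] on the boundary circle only; then let [eps] tend to 0.
    *)
Lemma maximum_modulus u s M : 0 <= s ->
  (forall h, modulus h <= s -> taylor2 u h) ->
  (forall h, modulus h = s -> modulus (u h) <= M) ->
  forall h, modulus h <= s -> modulus (u h) <= M.
Proof.
move=> s0 tu uM h hs; have M0 : 0 <= M.
  have := uM s%:C; rewrite modulus_real ger0_norm// => /(_ erefl).
  by apply: le_trans; exact: modulus_ge0.
rewrite -(ler_pXn2r (n := 2)) ?nnegrE ?modulus_ge0//.
apply/ler_addgt0Pr => e e0; pose eps := e / (s ^+ 2 + 1).
have s21 : 0 < s ^+ 2 + 1 by rewrite ltr_wpDl ?sqr_ge0.
have eps0 : 0 < eps by rewrite divr_gt0.
pose V (h : cplx R) := modulus (u h) ^+ 2 + eps * modulus h ^+ 2.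
have A0 : [set h : cplx R | modulus h <= s] !=set0.
  by exists 0; apply: le_trans s0; rewrite modulus0.
have cV : {within [set h : cplx R | modulus h <= s], continuous V}.
  apply: continuous_in_subspaceT => x /set_mem/= xs.
  have cu := taylor2_cvg_modulus (tu _ xs).
  have cx := taylor2_cvg_modulus (@taylor2_id R x).
  apply: (@cvgD _ _ _ (nbhs (x : cplx R)) _ (fun h => modulus (u h) ^+ 2)
    (fun h => eps * modulus h ^+ 2)).
    exact: (cvgM cu cu).
  apply: (@cvgM _ _ (nbhs (x : cplx R)) _ (cst eps)); first exact: cvg_cst.
  exact: (cvgM cx cx).
have [c cs Vc] := compact_EVT_max A0 (@compact_closed_disc R s) cV.
have {}cs : modulus c <= s by move/set_mem : cs.
have hV : V h <= V c by apply: Vc; apply/mem_set.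
have : modulus (u h) ^+ 2 <= V h by rewrite lerDl mulr_ge0 ?sqr_ge0// ltW.
move/le_trans => /(_ _ hV)/le_trans; apply.
have [cE|cE] := eqVneq (modulus c) s.
  rewrite /V cE lerD//.
    by rewrite ler_pXn2r ?nnegrE ?modulus_ge0//; exact: uM.
  by rewrite /eps mulrAC ler_pdivrMr// ler_wpM2l ?lerDl// ltW.
have cs' : 0 < s - modulus c by rewrite subr_gt0 lt_neqAle cE.
have [z zs] := no_interior_max (tu _ cs) eps0 cs'.
rewrite -/(V c) -/(V (c + z)) ltNge Vc//; apply/mem_set => /=.
rewrite -/(modulus _) (le_trans (ler_modulusD _ _))//.
by move: zs; rewrite ltrBrDl => /ltW.
Qed.

Lemma bernoulli_ineq (t : R) n : 0 <= t <= 1 -> 1 - n%:R * t <= (1 - t) ^+ n.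
Proof.
move=> /andP[t0 t1]; elim: n => [|n IH]; first by rewrite mul0r subr0 expr0.
rewrite exprSr; have t1' : 0 <= 1 - t by rewrite subr_ge0.
apply: le_trans (ler_wpM2r t1' IH); rewrite -natr1.
have : 0 <= n%:R * t * t by rewrite !mulr_ge0// ler0n.
by lra.
Qed.

(** Lets [s] tend to 1 in [A s^n <= 1], with Bernoulli's inequality providing
    the rate. *)
Lemma le1_of_scaled_le1 (a A : R) n : 0 <= A -> a < 1 ->
  (forall s, a <= s -> 0 < s < 1 -> A * s ^+ n <= 1) -> A <= 1.
Proof.
move=> A0 a1 H; apply/ler_addgt0Pr => e e0.
pose t := Num.min (Num.min (1 - a) (1 / 2)) (e / (A * n%:R + 1)).
have An : 0 <= A * n%:R by rewrite mulr_ge0// ler0n.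
have t0 : 0 < t by rewrite !lt_min subr_gt0 a1 !divr_gt0// ltr_wpDl.
have : t <= t by []; rewrite {2}/t !le_min -andbA => /and3P[ta t2 te].
have t1 : t <= 1 by lra.
have : A * (1 - t) ^+ n <= 1 by apply: H; lra.
have := @bernoulli_ineq t n; rewrite (ltW t0) t1 => /(_ isT)/(ler_wpM2l A0).
move: te; rewrite ler_pdivlMr ?ltr_wpDl// => te b1 b2.
by have := le_trans b1 b2; lra.
Qed.

(** The denominator of the disc automorphism sending [c] to 0 has no zero in
    the closed disc. *)
Lemma conj_mulr_lt1 (c z : cplx R) : modulus c < 1 -> modulus z <= 1 ->
  1 - c^*%C * z != 0.
Proof.
move=> c1 z1; rewrite subr_eq0; apply/eqP => /(congr1 (fun z => modulus z)) /eqP.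
rewrite modulus1 modulusM modulus_conj eq_sym lt_eqF//.
by rewrite (le_lt_trans _ c1)// ler_piMr ?modulus_ge0.
Qed.

Lemma moebius_identity (c z : cplx R) :
  modulus (1 - c^*%C * z) ^+ 2 - modulus (z - c) ^+ 2 =
  (1 - modulus c ^+ 2) * (1 - modulus z ^+ 2).
Proof.
rewrite !sqr_modulus; case: c z => [a b] [x y]; simpc => /=; ring.
Qed.

Lemma moebius_le (c z : cplx R) : modulus c < 1 -> modulus z <= 1 ->
  modulus (z - c) <= modulus (1 - c^*%C * z).
Proof.
move=> c1 z1; rewrite -(ler_pXn2r (n := 2)) ?nnegrE ?modulus_ge0//.
rewrite -subr_ge0 moebius_identity mulr_ge0// subr_ge0 exprn_ile1 ?modulus_ge0//.
exact: ltW.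
Qed.

(** The quotient [u = (g - c) / (h^n (1 - c^* g))] extends over 0 with value
    [v 0 / (1 - |c|^2)].  On the circle of radius [s] its modulus is at most
    [s^-n], because disc automorphisms map the closed disc into itself; by the
    maximum principle this bounds [u] inside, and [s] tends to 1.  Both
    conclusions are [|u| <= 1], at 0 and at [h]. *)
Lemma schwarz_pick g v (c : cplx R) n (d : R) : (0 < n)%N -> modulus c < 1 -> 0 < d ->
  (forall h, 0 < modulus h < 1 -> taylor2 g h) -> taylor2 v 0 ->
  (forall h, modulus h < d -> g h = c + h ^+ n * v h) ->
  (forall h, modulus h < 1 -> modulus (g h) <= 1) ->
  modulus (v 0) <= 1 - modulus c ^+ 2 /\
  forall h, modulus h < 1 ->
    modulus (g h - c) <= modulus h ^+ n * modulus (1 - c^*%C * g h).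
Proof.
move=> n0 c1 d0 tg tv gv g1.
have g0 : g 0 = c by rewrite gv ?modulus0// expr0n gtn_eqF// mul0r addr0.
have cc0 : c^*%C * c = (modulus c ^+ 2)%:C :> cplx R by rewrite mulrC mulr_conj.
pose u h := if h == 0 then v 0 / (1 - c^*%C * c)
            else (g h - c) / (h ^+ n * (1 - c^*%C * g h)).
have tu x : modulus x < 1 -> taylor2 u x.
  move=> x1; have [->|x0] := eqVneq x 0.
    (* The sum [c + h^n v h] is written with subtractions only, the operation
       for which stability was proved. *)
    have E : 1 - c^*%C * (c - (- (0 ^+ n * v 0))) != 0.
      by rewrite expr0n gtn_eqF// mul0r oppr0 subr0 conj_mulr_lt1// ltW.
    apply: (@taylor2_eq_near _
      (fun h => v h * (1 - c^*%C * (c - (0 - h ^+ n * v h)))^-1) _ _ d d0).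
      apply: taylor2M => //; apply: taylor2V.
        by rewrite sub0r.
      apply: taylor2B; first exact: taylor2_cst.
      apply: taylor2M; first exact: taylor2_cst.
      apply: taylor2B; first exact: taylor2_cst.
      apply: taylor2B; first exact: taylor2_cst.
      by apply: taylor2M => //; apply: taylor2X; exact: taylor2_id.
    move=> z zd; rewrite add0r sub0r opprK /u; case: eqP => [->|/eqP z0].
      by rewrite expr0n gtn_eqF// mul0r addr0.
    by rewrite gv// [c + _ - c]addrC addKr -mulf_div divff ?mul1r ?expf_neq0.
  have gx0 : 1 - c^*%C * g x != 0 by rewrite conj_mulr_lt1// g1.
  have xp : 0 < modulus x by rewrite modulus_gt0.
  have tgx : taylor2 g x by apply: tg; rewrite xp.
  apply: (@taylor2_eq_near _
    (fun h => (g h - c) * (h ^+ n * (1 - c^*%C * g h))^-1) _ _ _ xp).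
    apply: taylor2M; first by apply: taylor2B => //; exact: taylor2_cst.
    apply: taylor2V; first by rewrite mulf_neq0// expf_neq0.
    apply: taylor2M; first by apply: taylor2X; exact: taylor2_id.
    apply: taylor2B; first exact: taylor2_cst.
    by apply: taylor2M => //; exact: taylor2_cst.
  move=> z zx; rewrite /u; case: eqP => // /eqP xz.
  by move: zx; rewrite addrC addr_eq0 in xz; rewrite (eqP xz) modulusN ltxx.
have u1 h : modulus h < 1 -> modulus (u h) <= 1.
  move=> h1; apply: (@le1_of_scaled_le1 _ _ n (modulus_ge0 _) h1) => s hs /andP[s0 s1].
  rewrite -ler_pdivlMr ?exprn_gt0// mul1r.
  apply: (@maximum_modulus u s) => //; first exact: ltW.
    by move=> z zs; apply: tu; exact: le_lt_trans s1.
  move=> z zs; have z0 : z != 0 by rewrite -modulus_gt0 zs.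
  have z1 : modulus z < 1 by rewrite zs.
  have p0 : 0 < modulus (1 - c^*%C * g z) by rewrite modulus_gt0 conj_mulr_lt1// g1.
  rewrite /u (negbTE z0) modulusM modulusV modulusM modulusX zs invfM mulrCA.
  rewrite ler_piMr ?invr_ge0 ?exprn_ge0 ?(ltW s0)//.
  by rewrite ler_pdivrMr// mul1r moebius_le// g1.
split.
  have := u1 0; rewrite modulus0 => /(_ ltr01); rewrite /u eqxx.
  have c2 : 0 < 1 - modulus c ^+ 2.
    by rewrite subr_gt0 exprn_ilt1 ?modulus_ge0.
  rewrite cc0 modulusM modulusV (_ : 1 - _ = (1 - modulus c ^+ 2)%:C); last first.
    by rewrite rmorphB rmorph1.
  by rewrite modulus_real gtr0_norm// ler_pdivrMr// mul1r.
move=> h h1; have [->|h0] := eqVneq h 0.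
  by rewrite g0 subrr modulus0 expr0n gtn_eqF// mul0r.
have := u1 h h1; rewrite /u (negbTE h0).
have p0 : 0 < modulus (1 - c^*%C * g h) by rewrite modulus_gt0 conj_mulr_lt1// g1.
rewrite modulusM modulusV modulusM modulusX ler_pdivrMr ?mul1r//.
by rewrite mulr_gt0// exprn_gt0// modulus_gt0.
Qed.

End SchwarzPick.

(** * The Schwarz lemma and the Schwarz-Pick inequality *)

Section BoundedPowerSeries.
Variable R : realType.
Implicit Types (c : nat -> cplx R) (F g u v w : cplx R -> cplx R) (x z h s : cplx R).

(** The first [n] coefficients vanish, so the shifted series has the same disc
    of convergence and its sum is the quotient by [h^n]. *)
Lemma pseries_factor c F (r : R) n :
  (forall h, modulus h < r -> series (fun m => c m * h ^+ m) @ \oo --> F h) ->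
  (forall j, (j < n)%N -> c j = 0) ->
  exists v, (forall h, modulus h < r ->
      series (fun m => c (n + m)%N * h ^+ m) @ \oo --> v h) /\
    forall h, modulus h < r -> F h = h ^+ n * v h.
Proof.
elim: n c F => [|n IH] c F cF c0.
  by exists F; split => // h _; rewrite expr0 mul1r.
pose F1 h := if h == 0 then c 1%N else F h / h.
have cF1 h : modulus h < r -> series (fun m => c m.+1 * h ^+ m) @ \oo --> F1 h.
  move=> hr; rewrite /F1; case: eqP => [->|/eqP h0].
    exact: (@cvg_pseries_at0 _ (fun m => c m.+1)).
  have := cvg_series_shift (cF h hr); rewrite (c0 0%N (ltn0Sn _)) mul0r subr0 => S.
  have -> : series (fun m => c m.+1 * h ^+ m) =
      (fun n => series (fun m => c m.+1 * h ^+ m.+1) n * h^-1).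
    apply/funext => m; rewrite /series/= big_distrl/=; apply: eq_bigr => i _.
    by rewrite exprSr mulrA mulfK.
  by apply: cvgMl; exact S.
have [|v [cv F1v]] := IH (fun m => c m.+1) F1 cF1.
  by move=> j jn; exact: c0.
exists v; split.
  by move=> h hr; apply: eq_cvg_series (cv h hr) => m; rewrite addSn.
move=> h hr; rewrite exprS -mulrA -F1v// /F1; case: eqP => [h0|/eqP h0].
  have /pseries_at0 F0 : series (fun m => c m * 0 ^+ m) @ \oo --> F 0.
    by apply: cF; rewrite -h0.
  by rewrite h0 mul0r F0 c0.
by rewrite mulrC divfK.
Qed.

(** The case [c = 0] of [schwarz_pick].  A function of class [B] is only given
    by local power series, and its expansion at 0 need not be known to
    converge on the whole disc; this is why [schwarz_pick] asks for the
    factorization near 0 only. *)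
Lemma schwarz_lemma k w h : (0 < k)%N -> class_Bk k w -> modulus h < 1 ->
  modulus (w h) <= modulus h ^+ k.
Proof.
move=> k0 [[wan w1] wd _] h1.
have tw x : modulus x < 1 -> taylor2 w x.
  move=> x1; have [c [r [r0 cr]]] := wan x x1.
  have cw z : modulus z < r -> series (fun n => c n * z ^+ n) @ \oo --> w (x + z).
    by move=> zr; have := cr (x + z); rewrite [x + z - x]addrC addKr; exact.
  have [||a [b [e [be we]]]] := @taylor2_pseries _ c (fun z => w (x + z)) r 0.
  - exact: cw.
  - by rewrite modulus0.
  - exists a, b, e; split => // z.
    by have := we z; rewrite add0r addr0.
have D0 : modulus (0 : cplx R) < 1 by rewrite modulus0.
have [c [r [r0 cr]]] := wan 0 D0.
have cw z : modulus z < r -> series (fun n => c n * z ^+ n) @ \oo --> w z.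
  by move=> zr; have := cr z; rewrite subr0; exact.
have c0 j : (j < k)%N -> c j = 0.
  move=> jk; have := wd j jk; rewrite (pseries_derive1n j cw r0) => /eqP.
  by rewrite mulf_eq0 pnatr_eq0 eqn0Ngt fact_gt0/= => /eqP.
have [v [cv wv]] := pseries_factor cw c0.
have tv : taylor2 v 0 by apply: (taylor2_pseries cv); rewrite modulus0.
have tw' x : 0 < modulus x < 1 -> taylor2 w x by move=> /andP[_]; exact: tw.
have wv0 x : modulus x < r -> w x = 0 + x ^+ k * v x by rewrite add0r; exact: wv.
have [_ H] := schwarz_pick k0 D0 r0 tw' tv wv0 w1.
by have := H h h1; rewrite subr0 conjc0 mul0r subr0 modulus1 mulr1.
Qed.

Lemma schwarz_pick_pseries c g n : (0 < n)%N ->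
  (forall h, modulus h < 1 -> series (fun m => c m * h ^+ m) @ \oo --> g h) ->
  (forall h, modulus h < 1 -> modulus (g h) <= 1) ->
  modulus (c 0%N) < 1 -> (forall j, (0 < j < n)%N -> c j = 0) ->
  modulus (c n) <= 1 - modulus (c 0%N) ^+ 2 /\
  forall h, modulus h < 1 ->
    modulus (g h - c 0%N) <= modulus h ^+ n * modulus (1 - (c 0%N)^*%C * g h).
Proof.
move=> n0 cg g1 c01 cj.
pose c' m := if m == 0%N then 0 else c m.
have cg' h : modulus h < 1 ->
    series (fun m => c' m * h ^+ m) @ \oo --> g h - c 0%N.
  move=> h1; pose e m := if m == 0%N then c 0%N else 0.
  have es : series e @ \oo --> c 0%N.
    have := @cvg_series_finite _ e 1%N; rewrite big_nat1 /e /=; apply.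
    by case.
  apply: eq_cvg_series (cvg_seriesB (cg h h1) es) => -[|m].
    by rewrite /e /c' /= expr0 mulr1 subrr mul0r.
  by rewrite /e /c' /= subr0.
have c'0 j : (j < n)%N -> c' j = 0.
  by case: j => // j jn; rewrite /c' /= cj.
have [v [cv gv]] := pseries_factor cg' c'0.
have v0 : v 0 = c n.
  have := cv 0; rewrite modulus0 => /(_ ltr01)/pseries_at0 ->.
  by rewrite addn0 /c' gtn_eqF.
have tv : taylor2 v 0 by apply: (taylor2_pseries cv); rewrite modulus0.
have tg x : 0 < modulus x < 1 -> taylor2 g x.
  by move=> /andP[_ x1]; exact (taylor2_pseries cg x1).
have gcv h : modulus h < 1 -> g h = c 0%N + h ^+ n * v h.
  by move=> h1; rewrite -gv// addrC subrK.
by have := schwarz_pick n0 c01 ltr01 tg tv gcv g1; rewrite v0.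
Qed.

End BoundedPowerSeries.

(** * Coefficients of bounded power series *)

Section CoefficientBound.
Variable R : realType.
Implicit Types (c : nat -> cplx R) (F g u v w : cplx R -> cplx R) (x z h s : cplx R).

(** [X^n - 1] splits over the algebraically closed field [R[i]] and is
    separable in characteristic 0, so it has [n] distinct roots, and these
    form a cyclic group. *)
Lemma primitive_root_exists n : (0 < n)%N ->
  exists z : cplx R, n.-primitive_root z.
Proof.
move=> n_gt0; pose p : {poly R[i]} := 'X^n - 1.
have [r Dp] := closed_field_poly_normal p.
rewrite (monicP _) ?monicXnsubC // scale1r in Dp.
have rn1 : all n.-unity_root r by apply/allP => z; rewrite -root_prod_XsubC -Dp.
have sz_r : (n < (size r).+1)%N.
  by rewrite -(size_prod_XsubC r id) -Dp size_XnsubC.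
have [|z] := hasP (cyclic.has_prim_root n_gt0 rn1 _ sz_r); last by exists z.
rewrite -separable.separable_prod_XsubC -Dp cyclotomic.separable_Xn_sub_1 //.
by rewrite pnatr_eq0 -lt0n.
Qed.

Lemma modulus_root_of_unity z n : (0 < n)%N -> z ^+ n = 1 -> modulus z = 1.
Proof.
move=> n0 /(congr1 (fun z => modulus z)); rewrite modulusX modulus1 => /eqP.
by rewrite -[X in _ == X -> _](expr1n _ n) eqrXn2 ?modulus_ge0 ?ler01// => /eqP.
Qed.

Lemma sum_powers_root_of_unity z n m : n.-primitive_root z -> (0 < m < n)%N ->
  \sum_(0 <= j < n) z ^+ (j * m) = 0.
Proof.
move=> pz /andP[m0 mn]; rewrite big_mkord.
have zm1 : z ^+ m - 1 != 0.
  by rewrite subr_eq0 -(prim_order_dvd pz) gtnNdvd.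
apply: (mulfI zm1); rewrite mulr0.
under eq_bigr do rewrite mulnC exprM.
by rewrite -subrX1 exprAC (prim_expr_order pz) expr1n subrr.
Qed.

Lemma cvg_series_sum (u : nat -> nat -> cplx R) (l : nat -> cplx R) n :
  (forall j, series (u j) @ \oo --> l j) ->
  series (fun m => \sum_(0 <= j < n) u j m) @ \oo --> \sum_(0 <= j < n) l j.
Proof.
move=> ul; rewrite [X in X @ _ --> _](_ : _ =
    (fun N => \sum_(0 <= j < n) series (u j) N)).
  exact (@cvg_sum_nat R (fun j => series (u j)) l n ul).
by apply/funext => N; rewrite /series/= exchange_big.
Qed.

(** The mean of [g] over the rotations by [n]-th roots of unity is still
    bounded by 1, keeps the coefficients of index 0 and [n], and loses those
    in between; [schwarz_pick_pseries] then applies to it. *)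
Lemma coefficient_bound c g n : (0 < n)%N ->
  (forall h, modulus h < 1 -> series (fun m => c m * h ^+ m) @ \oo --> g h) ->
  (forall h, modulus h < 1 -> modulus (g h) <= 1) ->
  modulus (c 0%N) < 1 ->
  modulus (c n) <= 1 - modulus (c 0%N) ^+ 2.
Proof.
move=> n0 cg g1 c01; have [z pz] := primitive_root_exists n0.
have z1 : modulus z = 1 := modulus_root_of_unity n0 (prim_expr_order pz).
have nC : (n%:R : cplx R) != 0 by rewrite pnatr_eq0 -lt0n.
(* [A m] is 1 if [n] divides [m] and 0 otherwise: it filters the
   coefficients of the averaged function [G]. *)
pose A m := n%:R^-1 * \sum_(0 <= j < n) z ^+ (j * m).
pose G h := n%:R^-1 * \sum_(0 <= j < n) g (z ^+ j * h).
have zh j h : modulus (z ^+ j * h) = modulus h.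
  by rewrite modulusM modulusX z1 expr1n mul1r.
have cG h : modulus h < 1 ->
    series (fun m => (c m * A m) * h ^+ m) @ \oo --> G h.
  move=> h1.
  have S j : series (fun m => c m * (z ^+ j * h) ^+ m) @ \oo --> g (z ^+ j * h).
    by apply: cg; rewrite zh.
  have T := @cvg_series_sum _ _ n S.
  rewrite [X in X @ _ --> _](_ : _ = (fun N => n%:R^-1 * series (fun m =>
      \sum_(0 <= j < n) c m * (z ^+ j * h) ^+ m) N)).
    by apply: cvgMr; exact T.
  apply/funext => N; rewrite /series/= big_distrr/=; apply: eq_bigr => i _.
  have -> : \sum_(0 <= j < n) c i * (z ^+ j * h) ^+ i =
      (c i * h ^+ i) * \sum_(0 <= j < n) z ^+ (j * i).
    rewrite big_distrr/=; apply: eq_bigr => j _.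
    by rewrite exprMn -exprM; ring.
  by rewrite /A; ring.
have G1 h : modulus h < 1 -> modulus (G h) <= 1.
  move=> h1; rewrite /G modulusM modulusV modulus_nat mulrC ler_pdivrMr ?ltr0n//.
  rewrite mul1r (le_trans (modulus_sum _ _ _))//.
  apply: (@le_trans _ _ (\sum_(0 <= j < n) 1)).
    by apply: ler_sum => j _; apply: g1; rewrite zh.
  by rewrite big_const_nat subn0 iter_addr_0.
have A0 : A 0%N = 1.
  rewrite /A; under eq_bigr do rewrite muln0 expr0.
  by rewrite big_const_nat subn0 iter_addr_0 mulVf.
have An : A n = 1.
  rewrite /A; under eq_bigr do rewrite exprM exprAC (prim_expr_order pz) expr1n.
  by rewrite big_const_nat subn0 iter_addr_0 mulVf.
have cA j : (0 < j < n)%N -> c j * A j = 0.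
  by move=> jn; rewrite /A (sum_powers_root_of_unity pz jn) !mulr0.
have c0A : modulus (c 0%N * A 0%N) < 1 by rewrite A0 mulr1.
have [+ _] := schwarz_pick_pseries n0 cG G1 c0A cA.
by rewrite A0 An !mulr1.
Qed.

(** The inequality [|g h - c| <= |h| |1 - c^* g h|] confines [g h] to a
    hyperbolic disc around [c = c 0]; the point of that disc with largest
    modulus is [(a + |h|) / (1 + a |h|)], [a = |c|]. *)
Lemma schwarz_pick_growth c g h (rho : R) :
  (forall h, modulus h < 1 -> series (fun m => c m * h ^+ m) @ \oo --> g h) ->
  (forall h, modulus h < 1 -> modulus (g h) <= 1) ->
  modulus (c 0%N) < 1 -> modulus h <= rho < 1 ->
  modulus (g h) <= (modulus (c 0%N) + rho) / (1 + modulus (c 0%N) * rho).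
Proof.
move=> cg g1 c01 /andP[hr r1]; have h1 : modulus h < 1 := le_lt_trans hr r1.
have rho0 : 0 <= rho := le_trans (modulus_ge0 h) hr.
have c0j j : (0 < j < 1)%N -> c j = 0 by case: j.
have [_ /(_ h h1)] := schwarz_pick_pseries (ltn0Sn 0) cg g1 c01 c0j.
rewrite expr1; have G1 := g1 h h1.
have := moebius_identity (c 0%N) (g h).
have : 1 - modulus (c 0%N) * modulus (g h) <= modulus (1 - (c 0%N)^*%C * g h).
  by have := ler_subr_modulus 1 ((c 0%N)^*%C * g h); rewrite modulus1 modulusM modulus_conj.
move: (modulus_ge0 (1 - (c 0%N)^*%C * g h)) (modulus_ge0 (g h - c 0%N)).
move: G1 (modulus_ge0 (g h)) c01 (modulus_ge0 (c 0%N)) (modulus_ge0 h).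
move: (modulus (1 - (c 0%N)^*%C * g h)) (modulus (g h - c 0%N)) => X Y.
move: (modulus (g h)) (modulus (c 0%N)) (modulus h) hr => G a r rr.
move=> G1 G0 a1 a0 r0 X0 Y0 XaG E YX.
rewrite ler_pdivlMr; last by rewrite ltr_wpDr// mulr_ge0.
have aG : a * G < 1 by rewrite (le_lt_trans _ a1)// ler_piMr.
suff : G - a <= rho * (1 - a * G) by lra.
have [Ga|Ga] := lerP (G - a) 0.
  by rewrite (le_trans Ga)// mulr_ge0// subr_ge0 ltW.
rewrite -(ler_pXn2r (n := 2))// ?nnegrE ?mulr_ge0 ?subr_ge0 ?(ltW Ga) ?(ltW aG)//; last first.
  by rewrite -subr_ge0 ltW.
have YX2 : Y ^+ 2 <= rho ^+ 2 * X ^+ 2.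
  rewrite -exprMn ler_pXn2r ?nnegrE ?mulr_ge0// (le_trans YX)// ler_wpM2r//.
have XG2 : (1 - a * G) ^+ 2 <= X ^+ 2.
  by rewrite ler_pXn2r ?nnegrE// subr_ge0 ltW.
have rho2 : 0 <= 1 - rho ^+ 2 by rewrite subr_ge0 exprn_ile1// ltW.
have := ler_wpM2l rho2 XG2.
have -> : (rho * (1 - a * G)) ^+ 2 = rho ^+ 2 * (1 - a * G) ^+ 2 by ring.
have -> : (G - a) ^+ 2 = (1 - a * G) ^+ 2 - (1 - a ^+ 2) * (1 - G ^+ 2) by ring.
rewrite -E; lra.
Qed.

End CoefficientBound.

(** * The real inequality behind the radius *)

Section BohrInequality.
Variable R : realType.
Implicit Types (a p q r s t x rho : R) (k m N : nat).

Definition radius_poly k m N p r : R :=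
  2 * r ^+ (k * N) * (1 + r ^+ m) - p * (1 - r ^+ m) * (1 - r ^+ k).

(** [2 r^(kN) (1 + r^m)] increases with [r], while [1 - r^m] and [1 - r^k] are
    nonnegative and decrease. *)
Lemma radius_poly_mono k m N p r s : (0 < k)%N -> (0 < m)%N -> (0 < N)%N ->
  0 < p -> 0 <= r -> r < s -> s <= 1 ->
  radius_poly k m N p r < radius_poly k m N p s.
Proof.
move=> k0 m0 N0 p0 r0 rs s1; have s0 : 0 <= s := le_trans r0 (ltW rs).
have powlt n : (0 < n)%N -> r ^+ n < s ^+ n.
  by move=> n0; rewrite ltrXn2r// -lt0n.
have powle n : r ^+ n <= s ^+ n by rewrite lerXn2r// ltW.
have pow1 n : s ^+ n <= 1 by rewrite exprn_ile1.
have powr0 n : 0 <= r ^+ n by rewrite exprn_ge0.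
have kN0 : (0 < k * N)%N by rewrite muln_gt0 k0.
apply: ltr_leD.
  by rewrite -!mulrA ltr_pM2l// ltr_pM// ?powlt// ?ltrD2l ?powlt// addr_ge0.
rewrite lerN2 -!mulrA ler_pM2l//.
by apply: ler_pM; rewrite ?subr_ge0 ?pow1// lerD2l lerN2 powle.
Qed.

Lemma min_radius_root_exists k m N p : (0 < k)%N -> (0 < m)%N -> (0 < N)%N ->
  0 < p -> exists r, min_radius_root k m N p r.
Proof.
move=> k0 m0 N0 p0.
have kN0 : (0 < k * N)%N by rewrite muln_gt0 k0.
have phi0 : radius_poly k m N p 0 = - p.
  by rewrite /radius_poly !expr0n !gtn_eqF//=; ring.
have phi1 : radius_poly k m N p 1 = 4 by rewrite /radius_poly !expr1n; ring.
have cphi : continuous (radius_poly k m N p).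
  move=> x; have ce n := @exprn_continuous R n x.
  apply: cvgB.
    apply: cvgM; first by apply: cvgM; [exact: cvg_cst|exact: ce].
    by apply: cvgD; [exact: cvg_cst|exact: ce].
  apply: cvgM; last by apply: cvgB; [exact: cvg_cst|exact: ce].
  by apply: cvgM; [exact: cvg_cst|apply: cvgB; [exact: cvg_cst|exact: ce]].
have [|r] := @IVT R (radius_poly k m N p) 0 1 0 ler01 (continuous_subspaceT cphi).
  by rewrite phi0 phi1 ge_min le_max oppr_le0 ltW//= orbC ler0n.
rewrite in_itv/= => /andP[r0 r1] pr.
have root01 : 0 < r < 1.
  rewrite !lt_neqAle r0 r1 !andbT; apply/andP; split; apply/eqP => E.
    by move: pr; rewrite -E phi0; lra.
  by move: pr; rewrite E phi1; lra.
exists r; split; first by split.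
move=> s [/andP[s0 s1] ps]; rewrite leNgt; apply/negP => sr.
have := radius_poly_mono k0 m0 N0 p0 (ltW s0) sr r1.
by rewrite pr /radius_poly ps ltxx.
Qed.

(** For [q = p / 2 <= 1] the concave function [t^q] lies below its tangent at
    1, evaluated at [t = x^2].  With [L = ln t], this is [1 <= (1 - q) e^(-qL)
    + q e^(L - qL)], which follows from [e^y >= 1 + y] applied to both
    exponentials. *)
Lemma powR_le_chord x p : 0 <= x <= 1 -> 0 < p <= 2 ->
  x `^ p <= 1 - p / 2 * (1 - x ^+ 2).
Proof.
move=> /andP[x0 x1] /andP[p0 p2].
have [->|xn0] := eqVneq x 0.
  by rewrite powR0 ?gt_eqF// expr0n /= subr0 mulr1; lra.
have xp : 0 < x by rewrite lt_def xn0.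
rewrite /powR (negbTE xn0); set Y := p * ln x.
have eY := expR_gt0 Y.
have x2 : x ^+ 2 = expR (2 * ln x).
  by rewrite expRM_natl// lnK.
have h1 := expR_ge1Dx (- Y).
have h2 := expR_ge1Dx (2 * ln x - Y).
have : 1 <= (1 - p / 2) * expR (- Y) + p / 2 * expR (2 * ln x - Y).
  have q1 : 0 <= 1 - p / 2 by lra.
  have q2 : 0 <= p / 2 by lra.
  have := ler_wpM2l q1 h1; have := ler_wpM2l q2 h2; rewrite /Y; lra.
rewrite expRB expRN -x2 => /(ler_wpM2r (ltW eY)).
rewrite mul1r (_ : _ * expR Y = 1 - p / 2 + p / 2 * x ^+ 2); first lra.
by field; rewrite gt_eqF.
Qed.

(** From [e^y >= 1 + y] twice: [x^p >= 1 + p ln x] and [ln x >= 1 - 1/x]. *)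
Lemma powR_ge_tangent x p : 0 < x -> 0 < p -> 1 - p * (1 - x) / x <= x `^ p.
Proof.
move=> x0 p0; rewrite /powR gt_eqF//.
apply: le_trans (expR_ge1Dx _); rewrite lerD2l.
rewrite (_ : - _ = p * (1 - x^-1)); last by field; rewrite gt_eqF.
rewrite ler_pM2l//; have := expR_ge1Dx (- ln x); rewrite expRN lnK ?posrE//.
lra.
Qed.

(** All the dependence on [a] is in the factor [1 - a^2], common to the
    deficit of the first term and to the bound on the sum, and in [1 + a r^m],
    which is largest at [a = 1]. *)
Lemma bohr_real_inequality k m N p r a X : (0 < k)%N ->
  0 < p <= 2 -> 0 <= r < 1 -> 0 <= a < 1 ->
  0 <= X <= (a + r ^+ m) / (1 + a * r ^+ m) -> r ^+ m <= 1 ->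
  radius_poly k m N p r <= 0 ->
  X `^ p + (1 - a ^+ 2) * (r ^+ (k * N) / (1 - r ^+ k)) <= 1.
Proof.
move=> k0 p02 /andP[r0 r1] /andP[a0 a1] /andP[X0 XE] rm1.
have p0 : 0 < p by case/andP: p02.
have rk1 : r ^+ k < 1 by rewrite exprn_ilt1// -lt0n.
rewrite /radius_poly; set rho := r ^+ m in XE rm1 *; set T := r ^+ (k * N).
have rho0 : 0 <= rho by rewrite exprn_ge0.
have T0 : 0 <= T by rewrite exprn_ge0.
move: (r ^+ k) rk1 => t t1 phi.
have den : 0 < 1 + a * rho by rewrite ltr_wpDr// mulr_ge0.
set x := (a + rho) / (1 + a * rho) in XE.
have x1 : x <= 1 by rewrite ler_pdivrMr//; nra.
have X1 : 0 <= X <= 1 by rewrite X0 (le_trans XE).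
have := powR_le_chord X1 p02.
have XX : X ^+ 2 <= x ^+ 2 by rewrite ler_pXn2r ?nnegrE// (le_trans X0).
have x2E : 1 - x ^+ 2 = (1 - a ^+ 2) * ((1 - rho ^+ 2) / (1 + a * rho) ^+ 2).
  by rewrite /x; field; rewrite gt_eqF.
have low : (1 - rho) / (1 + rho) <= (1 - rho ^+ 2) / (1 + a * rho) ^+ 2.
  have d1 : 0 < 1 + rho by rewrite ltr_wpDr.
  rewrite ler_pdivrMr// mulrAC ler_pdivlMr ?exprn_gt0//.
  have -> : (1 - rho ^+ 2) * (1 + rho) = (1 - rho) * (1 + rho) ^+ 2 by ring.
  rewrite ler_wpM2l ?subr_ge0// ler_pXn2r//; last 2 first.
  - by rewrite nnegrE ltW.
  - by rewrite nnegrE ltW.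
  by rewrite lerD2l ler_piMl// ltW.
have ST : T / (1 - t) <= p / 2 * ((1 - rho) / (1 + rho)).
  have d1 : 0 < 1 + rho by rewrite ltr_wpDr.
  rewrite ler_pdivrMr ?subr_gt0// mulrA mulrAC ler_pdivlMr//.
  move: phi; lra.
have a2 : 0 <= 1 - a ^+ 2 by rewrite subr_ge0 exprn_ile1// ltW.
have p2 : 0 <= p / 2 by rewrite divr_ge0// ltW.
have := ler_wpM2l a2 (le_trans ST (ler_wpM2l p2 low)).
have : p / 2 * (1 - x ^+ 2) <= p / 2 * (1 - X ^+ 2).
  by rewrite ler_wpM2l// lerD2l lerN2.
rewrite x2E; set w := (1 - rho ^+ 2) / _.
have -> : p / 2 * ((1 - a ^+ 2) * w) = (1 - a ^+ 2) * (p / 2 * w) by ring.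
lra.
Qed.

Lemma geometric_tail_le t N n : 0 <= t < 1 ->
  \sum_(N <= i < n) t ^+ i <= t ^+ N / (1 - t).
Proof.
move=> t01; have /andP[t0 t1] := t01.
have tN : 0 <= t ^+ N by rewrite exprn_ge0.
have [nN|Nn] := leqP n N.
  by rewrite big_geq// mulr_ge0// invr_ge0 subr_ge0 ltW.
rewrite -{1}[N]add0n big_addn.
under eq_bigr do rewrite exprD mulrC.
by rewrite -big_distrr/= ler_wpM2l// geometric_sum_le.
Qed.

Lemma nneseries_le (u : nat -> R) N B : (forall n, 0 <= u n) ->
  (forall n, \sum_(N <= i < n) u i <= B) ->
  (\sum_(N <= n <oo) (u n)%:E <= B%:E)%E.
Proof.
move=> u0 uB; apply: lime_le.
  by apply: is_cvg_nneseries => n _ _; rewrite lee_fin.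
by apply: nearW => n; rewrite sumEFin lee_fin.
Qed.

Lemma partial_sum_le_nneseries (u : nat -> R) N n : (forall n, 0 <= u n) ->
  ((\sum_(N <= i < n) u i)%:E <= \sum_(N <= n <oo) (u n)%:E)%E.
Proof.
move=> u0; rewrite -sumEFin; apply: nneseries_lim_ge => i _ _.
by rewrite lee_fin.
Qed.


End BohrInequality.

(** * The Bohr inequality on slices *)

Section BohrHolds.
Variable R : realType.

Lemma homogeneous_polyZ d n (P : 'rV[cplx R]_d -> cplx R) (h : cplx R) b :
  homogeneous_poly n P -> P (h *: b) = h ^+ n * P b.
Proof.
move=> [A PA]; rewrite !PA big_distrr/=; apply: eq_bigr => al /eqP al_n.
rewrite mulrCA; congr (_ * _).
under eq_bigr do rewrite mxE exprMn.
by rewrite big_split/= -expr_sum al_n.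
Qed.

Lemma bohr_inequality_slice d k m N (p r0 : R) (Q : set 'rV[cplx R]_d) f P w1 w2 :
  (0 < k)%N -> (0 < m)%N -> (0 < N)%N -> 0 < p <= 2 ->
  radius_root k m N p r0 -> admissible Q f P ->
  class_Bk m w1 -> class_Bk k w2 -> bohr_ineq_in N p r0 Q f P w1 w2.
Proof.
move=> k0 m0 N0 p02 [/andP[r00 r01] r0root] [_ [Phom Pf] f01 f1] w1B w2B.
move=> b bQ h h1 hr0; have {}h1 : modulus h < 1 := h1.
pose c n := P n b; pose g (z : cplx R) := f (z *: b).
have cg z : modulus z < 1 -> series (fun n => c n * z ^+ n) @ \oo --> g z.
  move=> z1; apply: eq_cvg_series (Pf _ (bQ z z1)) => n.
  by rewrite /= (homogeneous_polyZ _ _ (Phom n)) mulrC.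
have g1 z : modulus z < 1 -> modulus (g z) <= 1.
  by move=> z1; apply/ltW/f1/bQ.
have D0 : modulus (0 : cplx R) < 1 by rewrite modulus0.
have c0E : c 0%N = f 0.
  by have /pseries_at0 <- := cg 0 D0; rewrite /g scale0r.
have c01 : modulus (c 0%N) < 1 by rewrite c0E.
set r := modulus h; have r_ge0 : 0 <= r := modulus_ge0 h.
have r1 : r < 1 by [].
have rpow1 n : (0 < n)%N -> r ^+ n < 1 by move=> n0; rewrite exprn_ilt1// -lt0n.
have w1h := schwarz_lemma m0 w1B h1; have w2h := schwarz_lemma k0 w2B h1.
have rm1 := rpow1 m m0.
have rk01 : 0 <= r ^+ k < 1 by rewrite exprn_ge0//= rpow1.
have w1r : modulus (w1 h) <= r ^+ m < 1 by rewrite w1h.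
have X1 := schwarz_pick_growth cg g1 c01 w1r.
set a := modulus (c 0%N) in X1 c01.
have a2 : 0 <= 1 - a ^+ 2 by rewrite subr_ge0 exprn_ile1 ?modulus_ge0// ltW.
have phi : radius_poly k m N p r <= 0.
  rewrite -r0root -/(radius_poly k m N p r0).
  have p0 : 0 < p by case/andP: p02.
  by apply/ltW/radius_poly_mono => //; exact: ltW.
have X0 : 0 <= modulus (g (w1 h)) <= (a + r ^+ m) / (1 + a * r ^+ m).
  by rewrite modulus_ge0.
have r01' : 0 <= r < 1 by rewrite r_ge0.
have a01 : 0 <= a < 1 by rewrite modulus_ge0.
have := bohr_real_inequality k0 p02 r01' a01 X0 (ltW rm1) phi.
rewrite /bohr_ineq -lee_fin EFinD; apply: le_trans; apply: leeD => //.
apply: nneseries_le => [n|n].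
  by rewrite mulr_ge0 ?exprn_ge0 ?modulus_ge0.
rewrite exprM; apply: le_trans (ler_wpM2l a2 (geometric_tail_le N n rk01)).
rewrite big_distrr/= big_nat_cond [leRHS]big_nat_cond.
apply: ler_sum => i /andP[/andP[Ni _] _].
apply: ler_pM; rewrite ?modulus_ge0 ?exprn_ge0 ?modulus_ge0//.
  by apply: (coefficient_bound _ cg g1 c01); exact: leq_trans Ni.
by rewrite lerXn2r ?nnegrE ?modulus_ge0// exprn_ge0.
Qed.

End BohrHolds.

(** * Dominated complex linear functionals in finite dimension *)

Section HahnBanach.
Variable (R : realType) (V : lmodType (cplx R)).
Implicit Types (q : V -> R) (x y v : V) (t : R).

(** Homogeneity is only required for nonnegative real scalars: the functionals
    met below are real, and complex rotations enter separately. *)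
Definition sublinear q := (forall x y, q (x + y) <= q x + q y) /\
  forall t x, 0 <= t -> q (t%:C *: x) = t * q x.

(** A sublinear functional is linear along the real line of [v] exactly when
    it is odd at [v]. *)
Definition odd_at q v := q (- v) = - q v.

Lemma sublinear0 q : sublinear q -> q 0 = 0.
Proof. by move=> [_ /(_ 0 0 (lexx _))]; rewrite scaler0 mul0r. Qed.

Lemma sublinearN q x : sublinear q -> - q (- x) <= q x.
Proof.
move=> sq; have := sq.1 x (- x); rewrite subrr (sublinear0 sq); lra.
Qed.

(** The functional [q' x = inf_(t >= 0) (q (x + t v) - t q v)] is the largest
    sublinear functional below [q] that is linear along [v] and takes the
    value [q v] there. *)
Lemma refine_sublinear q v : sublinear q -> exists q',
  [/\ sublinear q', forall x, q' x <= q x, odd_at q' v & q' v = q v].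
Proof.
move=> sq; have [qD qZ] := sq.
pose S x := [set q (x + t%:C *: v) - t * q v | t in [set t | 0 <= t]].
have Sx x t : 0 <= t -> S x (q (x + t%:C *: v) - t * q v) by move=> t0; exists t.
have S0 x : S x !=set0 by exists (q (x + 0%:C *: v) - 0 * q v); exact: Sx.
have Slb x : lbound (S x) (- q (- x)).
  move=> _ [t t0 <-]; rewrite -(qZ t v t0).
  by have := qD (x + t%:C *: v) (- x); rewrite [x + _ - x]addrC addKr; lra.
have lbS x : has_lbound (S x) by exists (- q (- x)).
pose q' x := inf (S x).
have q'_le x t : 0 <= t -> q' x <= q (x + t%:C *: v) - t * q v.
  by move=> t0; apply: ge_inf => //; exact: Sx.
have q'_ge x c : (forall t, 0 <= t -> c <= q (x + t%:C *: v) - t * q v) -> c <= q' x.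
  by move=> H; apply: lb_le_inf => // _ [t t0 <-]; exact: H.
have q'0 : q' 0 = 0.
  apply/eqP; rewrite eq_le; apply/andP; split.
    by have := q'_le 0 0 (lexx _); rewrite scale0r addr0 mul0r subr0 (sublinear0 sq).
  by apply: (q'_ge) => t t0; rewrite add0r qZ// subrr.
have q'Z_ge t x : 0 < t -> t * q' x <= q' (t%:C *: x).
  move=> t0; apply: (q'_ge) => s s0.
  have := q'_le x (s / t) (divr_ge0 s0 (ltW t0)).
  rewrite -(ler_pM2l t0) => /le_trans; apply.
  have ts : t * (s / t) = s by rewrite mulrC divfK ?gt_eqF.
  by rewrite mulrBr -(qZ _ _ (ltW t0)) scalerDr scalerA -rmorphM [t * (_ * q v)]mulrA ts.
have sq' : sublinear q'.
  split => [x y|t x].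
    rewrite -lerBlDr; apply: (q'_ge) => t t0.
    rewrite lerBlDr -lerBlDl; apply: (q'_ge) => s s0.
    have := q'_le (x + y) (t + s) (addr_ge0 t0 s0).
    have := qD (x + t%:C *: v) (y + s%:C *: v).
    by rewrite addrACA -scalerDl -rmorphD; lra.
  rewrite le_eqVlt => /predU1P[<-|t0]; first by rewrite scale0r mul0r.
  apply/eqP; rewrite eq_le q'Z_ge// andbT.
  have ti0 : 0 < t^-1 by rewrite invr_gt0.
  have := q'Z_ge t^-1 (t%:C *: x) ti0.
  rewrite scalerA -rmorphM mulVf ?gt_eqF// scale1r.
  by rewrite ler_pdivrMl.
have q'q x : q' x <= q x.
  by have := q'_le x 0 (lexx _); rewrite scale0r addr0 mul0r subr0.
have q'Nv : q' (- v) <= - q v.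
  have := q'_le (- v) 1 ler01.
  by rewrite scale1r addNr mul1r (sublinear0 sq) sub0r.
have := sublinearN v sq'; have := q'q v; rewrite /odd_at => h1 h2.
by exists q'; split => //; lra.
Qed.

(** Going down among sublinear functionals preserves linearity along a
    direction, so directions can be treated one after the other. *)
Lemma odd_at_le q q' v : sublinear q' -> (forall x, q' x <= q x) ->
  odd_at q v -> odd_at q' v /\ q' v = q v.
Proof.
rewrite /odd_at => sq' q'q qv.
have := q'q v; have := q'q (- v); have := sublinearN v sq'; rewrite qv.
by move=> h1 h2 h3; split; lra.
Qed.

Lemma refine_sublinear_seq q (s : seq V) : sublinear q -> exists q',
  [/\ sublinear q', forall x, q' x <= q x & forall v, v \in s -> odd_at q' v].
Proof.
move=> sq; elim: s => [|v s [q1 [sq1 q1q odd1]]]; first by exists q.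
have [q2 [sq2 q2q1 odd2 _]] := refine_sublinear v sq1.
exists q2; split => //; first by move=> x; exact: le_trans (q2q1 x) (q1q x).
move=> y; rewrite inE => /predU1P[->//|ys].
by have [] := odd_at_le sq2 q2q1 (odd1 y ys).
Qed.

Lemma odd_atD q x y : sublinear q -> odd_at q x -> odd_at q y ->
  odd_at q (x + y) /\ q (x + y) = q x + q y.
Proof.
rewrite /odd_at => sq qx qy; have [qD _] := sq.
have h1 := qD x y; have h2 := qD (- x) (- y); have h3 := sublinearN (x + y) sq.
by move: h2; rewrite -opprD => h2; split; lra.
Qed.

Lemma odd_atZ q t x : sublinear q -> odd_at q x ->
  odd_at q (t%:C *: x) /\ q (t%:C *: x) = t * q x.
Proof.
rewrite /odd_at => -[_ qZ] qx; have [t0|t0] := lerP 0 t.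
  by rewrite -scalerN !qZ// qx mulrN.
have nt0 : 0 <= - t by rewrite oppr_ge0 ltW.
have -> : t%:C *: x = (- t)%:C *: - x by rewrite rmorphN scaleNr scalerN opprK.
by rewrite -scalerN opprK !qZ// qx mulrNN mulNr.
Qed.

End HahnBanach.

Section ComplexFunctional.
Variables (R : realType) (d : nat).
Local Notation V := 'rV[cplx R]_d.
Implicit Types (q : V -> R) (x y v : V) (c : cplx R).

(** Hahn-Banach without transfinite induction: [refine_sublinear] is applied
    to [b] and then to a real basis, and the directions along which a
    sublinear functional is linear are closed under linear combinations. *)
Lemma real_functional q (b : V) : sublinear q -> exists q',
  [/\ sublinear q', forall x, q' x <= q x, q' b = q b & forall x, odd_at q' x].
Proof.
move=> sq; have [q1 [sq1 q1q odd1 q1b]] := refine_sublinear b sq.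
pose s := [seq (delta_mx 0 i : V) | i <- enum 'I_d] ++
  [seq ('i : cplx R) *: (delta_mx 0 i : V) | i <- enum 'I_d].
have [q2 [sq2 q2q1 odd2]] := refine_sublinear_seq s sq1.
exists q2; split => //.
- by move=> x; exact: le_trans (q2q1 x) (q1q x).
- by have [_ ->] := odd_at_le sq2 q2q1 odd1.
move=> x; rewrite (row_sum_delta x); apply: big_ind.
- by rewrite /odd_at oppr0 (sublinear0 sq2) oppr0.
- by move=> y z oy oz; have [] := odd_atD sq2 oy oz.
move=> i _; rewrite [x 0 i]complexE scalerDl mulrC -scalerA.
have o1 : odd_at q2 (delta_mx 0 i).
  apply: odd2; rewrite mem_cat; apply/orP; left.
  by apply/mapP; exists i; rewrite ?mem_enum.
have o2 : odd_at q2 (('i : cplx R) *: delta_mx 0 i).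
  apply: odd2; rewrite mem_cat; apply/orP; right.
  by apply/mapP; exists i; rewrite ?mem_enum.
have [h3 _] := odd_atZ (complex.Re (x 0 i)) sq2 o1.
have [h4 _] := odd_atZ (complex.Im (x 0 i)) sq2 o2.
by have [] := odd_atD sq2 h3 h4.
Qed.

(** The complex form whose real part is the real functional [u] is [x |-> u x
    - i u (i x)].  At a given [x], rotating by the phase that makes its value
    positive real turns its modulus into a value of [u], hence [<= q x]. *)
Lemma complex_functional q (b : V) : sublinear q ->
  (forall c x, modulus c = 1 -> q (c *: x) = q x) ->
  exists l : 'I_d -> cplx R,
    (forall x, modulus (\sum_i x 0 i * l i) <= q x) /\
    modulus (\sum_i b 0 i * l i) = q b.
Proof.
move=> sq qrot; have [u [su uq ub uodd]] := real_functional b sq.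
have uD x y : u (x + y) = u x + u y by have [] := odd_atD su (uodd x) (uodd y).
have uZ t x : u (t%:C *: x) = t * u x by have [] := odd_atZ t su (uodd x).
pose L x : cplx R := (u x +i* - u (('i : cplx R) *: x))%C.
have LD x y : L (x + y) = L x + L y.
  by rewrite /L scalerDr !uD opprD.
have L0 : L 0 = 0 by rewrite /L scaler0 (sublinear0 su) oppr0.
have LZ c x : L (c *: x) = c * L x.
  have iE x' : ('i : cplx R) *: (('i : cplx R) *: x') = (-1)%:C *: x'.
    by rewrite scalerA; congr (_ *: _); simpc.
  have iC t x' : ('i : cplx R) *: (t%:C *: x') = t%:C *: (('i : cplx R) *: x').
    by rewrite !scalerA mulrC.
  case: c => al be; set y := ('i : cplx R) *: x.
  have cx : (al +i* be)%C *: x = al%:C *: x + be%:C *: y.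
    by rewrite /y scalerA -scalerDl; congr (_ *: _); simpc.
  have icx : ('i : cplx R) *: ((al +i* be)%C *: x) = al%:C *: y + (- be)%:C *: x.
    by rewrite /y !scalerA -scalerDl; congr (_ *: _); simpc.
  rewrite /L icx cx -/y uD (uD (al%:C *: y)) (uZ al x) (uZ be y) (uZ al y).
  rewrite (uZ (- be) x); move: (u x) (u y) => ux uy.
  by apply/eqP; rewrite eq_complex /=; apply/andP; split; apply/eqP; ring.
have LE x : L x = \sum_i x 0 i * L (delta_mx 0 i).
  rewrite [in LHS](row_sum_delta x) (big_morph L LD L0).
  by apply: eq_bigr => i _; rewrite LZ.
have q0 x : 0 <= q x.
  have := sublinearN x sq; rewrite -scaleN1r qrot ?modulusN ?modulus1//; lra.
have Lq x : modulus (L x) <= q x.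
  have [->|Lx] := eqVneq (L x) 0; first by rewrite modulus0.
  (* The phase for which [L (w *: x)] is the modulus of [L x]. *)
  pose w : cplx R := (L x)^*%C / (modulus (L x))%:C.
  have m0 : modulus (L x) != 0 by rewrite modulus_eq0.
  have w1 : modulus w = 1.
    rewrite modulusM modulus_conj modulusV modulus_real ger0_norm ?modulus_ge0//.
    by rewrite divff.
  rewrite -(qrot w x w1); apply: le_trans (uq _).
  suff LwE : L (w *: x) = (modulus (L x))%:C by rewrite -[leRHS]/(complex.Re (L (w *: x))) LwE.
  rewrite LZ /w mulrAC [_ * L x]mulrC mulr_conj rmorphXn expr2 mulfK//.
  by rewrite fmorph_eq0.
exists (fun i => L (delta_mx 0 i)); split => [x|]; rewrite -LE; first exact: Lq.
apply/eqP; rewrite eq_le Lq -ub.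
by rewrite (le_trans _ (normRe_le _))//= ler_norm.
Qed.

End ComplexFunctional.

(** * Supporting functionals of circular convex domains *)

Section SupportingFunctional.
Variables (R : realType) (d : nat).
Local Notation V := 'rV[cplx R]_d.
Implicit Types (Q : set V) (x y v : V) (c : cplx R) (s t : R).

(** Openness enters through this form only: a point of [Q] can be moved a
    little in any direction. *)
Lemma open_line Q x y : open Q -> Q x ->
  exists2 e : R, 0 < e & forall t, 0 <= t <= e -> Q (x + t%:C *: y).
Proof.
move=> oQ Qx; have /nbhs_ballP [r /= r0 rQ] := open_nbhs_nbhs (conj oQ Qx).
have n0 : 0 <= `|y| by [].
have nE : `|y| = (complex.Re `|y|)%:C by rewrite RRe_real// ger0_real.
have rE : r = (complex.Re r)%:C by rewrite RRe_real// gtr0_real.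
have r0' : 0 < complex.Re r by rewrite rE ltcR in r0.
have n0' : 0 <= complex.Re `|y| by rewrite nE lecR in n0.
exists (complex.Re r / (complex.Re `|y| + 1) / 2).
  by rewrite !divr_gt0// ltr_wpDl.
move=> t /andP[t0 te]; apply: rQ; rewrite -ball_normE /= opprD addrA subrr sub0r.
rewrite normrN normrZ nE rE normE modulus_real ger0_norm// -rmorphM ltcR.
have : t < complex.Re r / (complex.Re `|y| + 1).
  have w0 : 0 < complex.Re r / (complex.Re `|y| + 1) by rewrite divr_gt0// ltr_wpDl.
  by rewrite (le_lt_trans te)//; lra.
rewrite ltr_pdivlMr ?ltr_wpDl//; apply: le_lt_trans.
by rewrite ler_wpM2l// lerDl.
Qed.

Lemma convex_set_segment Q x y t : convex_set Q -> Q x -> Q y -> 0 <= t <= 1 ->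
  Q (t%:C *: x + (1 - t)%:C *: y).
Proof.
move=> cQ Qx Qy /andP[t0 t1].
have t0' : 0 <= t%:C :> cplx R by rewrite lecR.
have t1' : t%:C <= 1 :> cplx R by rewrite lecR.
have := cQ x y (Itv01 t0' t1') (mem_set Qx) (mem_set Qy).
by move/set_mem; rewrite rmorphB rmorph1.
Qed.

(** The Minkowski functional. *)
Definition gauge Q x : R := inf [set t | 0 < t /\ Q ((t^-1)%:C *: x)].

Section Gauge.
Variable Q : set V.
Hypotheses (oQ : open Q) (Q0 : Q 0) (cQ : convex_set Q).
Hypothesis circ : forall c z, modulus c <= 1 -> Q z -> Q (c *: z).

Let G x := [set t | 0 < t /\ Q ((t^-1)%:C *: x)].

Let G_neq0 x : G x !=set0.
Proof.
have [e e0 /(_ e)] := open_line x oQ Q0.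
rewrite (ltW e0) lexx add0r => /(_ isT) Qe.
by exists e^-1; split; rewrite ?invr_gt0// invrK.
Qed.

Let G_lb x : has_lbound (G x).
Proof. by exists 0 => t [/ltW]. Qed.

Let gauge_le x t : G x t -> gauge Q x <= t.
Proof. exact: ge_inf. Qed.

Let le_gauge x s : (forall t, G x t -> s <= t) -> s <= gauge Q x.
Proof. by move=> H; exact: (lb_le_inf (G_neq0 x) H). Qed.

Lemma gauge_ge0 x : 0 <= gauge Q x.
Proof. by apply: le_gauge => t [/ltW]. Qed.

(** Membership follows from [gauge < 1] since [Q] is circular; conversely an
    open set contains a slightly dilated copy of each of its points. *)
Lemma gauge_lt1 x : gauge Q x < 1 <-> Q x.
Proof.
split.
  rewrite -subr_gt0 => g1; have := inf_adherent g1 (conj (G_neq0 x) (G_lb x)).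
  move=> [t [t0 Qt]]; rewrite -/(gauge Q x) addrC subrK => t1.
  have := circ (c := t%:C) _ Qt; rewrite scalerA -rmorphM divff ?gt_eqF//.
  by rewrite scale1r modulus_real gtr0_norm//; apply; exact: ltW.
move=> Qx; have [e e0 /(_ e)] := open_line x oQ Qx.
rewrite (ltW e0) lexx => /(_ isT) Qe.
have e1 : 0 < 1 + e by rewrite addr_gt0.
apply: (@le_lt_trans _ _ (1 + e)^-1); last by rewrite invf_lt1// ltrDl.
apply: gauge_le; split; first by rewrite invr_gt0.
by rewrite invrK rmorphD scalerDl rmorph1 scale1r.
Qed.

Lemma gauge_rotation c x : modulus c = 1 -> gauge Q (c *: x) = gauge Q x.
Proof.
have le c' x' : modulus c' = 1 -> gauge Q (c' *: x') <= gauge Q x'.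
  move=> c1; apply: le_gauge => t [t0 Qt]; apply: gauge_le; split => //.
  by rewrite scalerA mulrC -scalerA; apply: circ; rewrite ?c1.
move=> c1; apply/eqP; rewrite eq_le le//=.
have c0 : c != 0 by rewrite -modulus_gt0 c1.
have := le c^-1 (c *: x); rewrite scalerA mulVf// scale1r modulusV c1 invr1.
exact.
Qed.

(** Subadditivity is convexity: if [x / s] and [y / t] are in [Q], then [(x +
    y) / (s + t)] is the convex combination of these points with weights [s /
    (s + t)] and [t / (s + t)]. *)
Lemma gauge_sublinear : sublinear (gauge Q).
Proof.
have gZ_le t x : 0 < t -> gauge Q (t%:C *: x) <= t * gauge Q x.
  move=> t0; rewrite -ler_pdivrMl//; apply: le_gauge => s [s0 Qs].
  rewrite ler_pdivrMl//; apply: gauge_le; split; first by rewrite mulr_gt0.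
  by rewrite scalerA -rmorphM invfM mulrAC mulVf ?gt_eqF// mul1r.
split => [x y|t x].
  rewrite -lerBlDr; apply: le_gauge => s [s0 Qs].
  rewrite lerBlDr -lerBlDl; apply: le_gauge => t [t0 Qt].
  rewrite lerBlDl; apply: gauge_le; split; first by rewrite addr_gt0.
  have st0 : 0 < s + t by rewrite addr_gt0.
  have st1 : 0 <= s / (s + t) <= 1.
    rewrite divr_ge0 ?(ltW s0) ?(ltW st0)//=.
    by rewrite ler_pdivrMr// mul1r lerDl ltW.
  have := convex_set_segment cQ Qs Qt st1; rewrite !scalerA -!rmorphM.
  rewrite (_ : s / (s + t) * s^-1 = (s + t)^-1); last first.
    by field; rewrite ?gt_eqF.
  rewrite (_ : (1 - s / (s + t)) * t^-1 = (s + t)^-1) ?scalerDr//.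
  by field; rewrite ?gt_eqF.
rewrite le_eqVlt => /predU1P[<-|t0].
  rewrite scale0r mul0r; apply/eqP; rewrite eq_le gauge_ge0 andbT.
  apply/ler_addgt0Pr => e e0; rewrite add0r; apply: gauge_le.
  by split => //; rewrite scaler0.
apply/eqP; rewrite eq_le gZ_le//=.
have ti0 : 0 < t^-1 by rewrite invr_gt0.
have := gZ_le t^-1 (t%:C *: x) ti0.
rewrite scalerA -rmorphM mulVf ?gt_eqF// scale1r.
by rewrite ler_pdivlMl.
Qed.

End Gauge.

(** If [z] is outside [Q], its gauge is positive, and normalizing it gives [b]
    with gauge 1, hence with [bD] inside [Q].  A linear form dominated by the
    gauge and of modulus 1 at [b] is strictly below 1 on [Q]; a rotation of
    [b] makes the value there equal to 1. *)
Lemma supporting_functional Q : complete_circular_domain Q -> convex_set Q ->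
  Q <> setT -> exists (l : 'I_d -> cplx R) (b : V),
  [/\ forall x, Q x -> modulus (\sum_i x 0 i * l i) < 1,
      \sum_i b 0 i * l i = 1 &
      forall h, modulus h < 1 -> Q (h *: b)].
Proof.
move=> [oQ _ Q0 circ] cQ QT.
have [z Qz] : exists z, ~ Q z.
  apply: contrapT => /forallNP H; apply: QT; apply/seteqP; split => // x _.
  exact: contrapT (H x).
have sg := gauge_sublinear oQ Q0 cQ; have lt1 := gauge_lt1 oQ Q0 circ.
have mz : 1 <= gauge Q z by rewrite leNgt; apply/negP => /lt1.
have mz0 : 0 < gauge Q z := lt_le_trans ltr01 mz.
have rot := gauge_rotation oQ Q0 circ.
pose b := ((gauge Q z)^-1)%:C *: z.
have gb : gauge Q b = 1.
  by rewrite sg.2 ?invr_ge0 ?(ltW mz0)// mulVf ?gt_eqF.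
have [l [lg lb]] := complex_functional b sg rot.
rewrite gb in lb; set lam := \sum_i b 0 i * l i in lb.
have lam0 : lam != 0 by rewrite -modulus_gt0 lb.
exists l, (lam^-1 *: b); split.
- by move=> x /lt1; exact: le_lt_trans.
- under eq_bigr do rewrite mxE -mulrA.
  by rewrite -big_distrr/= -/lam mulVf.
move=> h h1; apply/lt1; rewrite scalerA.
have [->|h0] := eqVneq h 0; first by rewrite mul0r scale0r (sublinear0 sg).
have hm0 : modulus h != 0 by rewrite modulus_eq0.
pose c := h / lam / (modulus h)%:C.
have c1 : modulus c = 1.
  rewrite /c !modulusM !modulusV lb modulus_real ger0_norm ?modulus_ge0//.
  by rewrite invr1 mulr1 divff.
have -> : h / lam = (modulus h)%:C * c.
  by rewrite /c [RHS]mulrC divfK// fmorph_eq0.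
by rewrite -scalerA sg.2 ?modulus_ge0// (rot _ _ c1) gb mulr1.
Qed.

End SupportingFunctional.

(** * The extremal functions *)

Section Extremal.
Variable R : realType.
Implicit Types (c : nat -> cplx R) (F g : cplx R -> cplx R) (h s w z : cplx R).

Lemma class_Bk_monomial k : class_Bk k (fun h : cplx R => h ^+ k).
Proof.
pose c n : cplx R := if n == k then 1 else 0.
have cE h : series (fun n => c n * h ^+ n) @ \oo --> h ^+ k.
  have := @cvg_series_finite _ (fun n => c n * h ^+ n) k.+1.
  rewrite big_nat_recr//= big_nat_cond big1 => [|i].
    rewrite add0r /c eqxx mul1r; apply => n kn.
    by rewrite gtn_eqF// mul0r.
  by rewrite andbT => /andP[_ ik]; rewrite /c ltn_eqF// mul0r.
have dE n := @pseries_derive1n R c (fun h => h ^+ k) 1 n (fun h _ => cE h) ltr01.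
split.
- split => [h0 _|h h1].
    exists (fun n => h0 ^+ (k - n) *+ 'C(k, n)), 1; split => // h _.
    have -> : h ^+ k = \sum_(0 <= n < k.+1)
        (h0 ^+ (k - n) *+ 'C(k, n)) * (h - h0) ^+ n.
      rewrite -{1}[h](subrK h0) addrC exprDn big_mkord.
      by apply: eq_bigr => i _; rewrite mulrnAl.
    apply: cvg_series_finite => n kn.
    by rewrite /= bin_small// mulr0n mul0r.
  have {}h1 : modulus h < 1 := h1.
  by rewrite modulusX exprn_ile1 ?modulus_ge0// ltW.
- by move=> j jk; rewrite dE /c ltn_eqF// mulr0.
- rewrite dE /c eqxx mulr1 => /eqP; rewrite pnatr_eq0 => /eqP E.
  by have := fact_gt0 k; rewrite E.
Qed.

Lemma cvg_series_unshift (u : nat -> cplx R) s :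
  series (fun n => u n.+1) @ \oo --> s -> series u @ \oo --> u 0%N + s.
Proof.
move=> us.
have : (fun n => series u n.+1) @ \oo --> u 0%N + s.
  rewrite [X in X @ _ --> _](_ : _ =
    cst (u 0%N) \+ series (fun n => u n.+1)).
    exact (cvgD (cvg_cst _) us).
  by apply/funext => n; rewrite /series/= big_nat_recl.
by rewrite cvg_shiftS.
Qed.

(** The sum [s] satisfies [s - 1 = z s] by shifting the index. *)
Lemma geometric_series z : modulus z < 1 ->
  series (fun n => z ^+ n) @ \oo --> (1 - z)^-1.
Proof.
move=> z1.
have [s zs] : exists s : cplx R, series (fun n => z ^+ n) @ \oo --> s.
  apply: (@absolutely_summable _ _ (1 - modulus z)^-1) => n.
  under eq_bigr do rewrite modulusX.
  by apply: geometric_sum_le; rewrite modulus_ge0.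
have shift := cvg_series_shift zs; rewrite expr0 in shift.
have zz : series (fun n => z ^+ n.+1) @ \oo --> z * s.
  rewrite [X in X @ _ --> _](_ : _ = (fun n => z * series (fun n => z ^+ n) n)).
    by apply: cvgMr; exact zs.
  apply/funext => n; rewrite /series/= big_distrr/=.
  by apply: eq_bigr => i _; rewrite exprS.
have E : s - 1 = z * s.
  by apply: (cvg_unique _ shift zz); exact: norm_hausdorff.
have z0 : 1 - z != 0.
  rewrite subr_eq0; apply: contraTneq z1 => <-.
  by rewrite modulus1 ltxx.
have -> : (1 - z)^-1 = s.
  by apply: (mulfI z0); rewrite mulfV// mulrBl mul1r -E; ring.
exact zs.
Qed.

(** The coefficients of [(a + w) / (1 + a w)]. *)
Definition moebius_coef (a : R) n : cplx R :=
  if n is n'.+1 then (1 - a ^+ 2)%:C * ((- a) ^+ n')%:C else a%:C.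

Lemma modulus_moebius_coef a n : 0 <= a < 1 ->
  modulus (moebius_coef a n.+1) = (1 - a ^+ 2) * a ^+ n.
Proof.
move=> /andP[a0 a1]; rewrite /moebius_coef modulusM !modulus_real.
rewrite normrX normrN (ger0_norm a0) ger0_norm// subr_ge0 exprn_ile1//.
exact: ltW.
Qed.

Lemma moebius_den_neq0 (a : R) w : 0 <= a < 1 -> modulus w < 1 ->
  1 + a%:C * w != 0.
Proof.
move=> /andP[a0 a1] w1; have := @conj_mulr_lt1 R (- a)%:C w.
rewrite modulus_real normrN ger0_norm// => /(_ a1 (ltW w1)).
by rewrite conjc_real rmorphN mulNr opprK.
Qed.

Lemma moebius_series (a : R) w : 0 <= a < 1 -> modulus w < 1 ->
  series (fun n => moebius_coef a n * w ^+ n) @ \oo -->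
    ((a%:C + w) / (1 + a%:C * w) : cplx R).
Proof.
move=> a01 w1; have /andP[a0 a1] := a01.
have z1 : modulus (- (a%:C * w)) < 1.
  rewrite modulusN modulusM modulus_real ger0_norm//.
  by rewrite (le_lt_trans _ a1)// ler_piMr// ltW.
have den := moebius_den_neq0 a01 w1.
have -> : (a%:C + w) / (1 + a%:C * w) = moebius_coef a 0 * w ^+ 0 +
    (1 - a ^+ 2)%:C * w * (1 - - (a%:C * w))^-1.
  by rewrite /= expr0 mulr1 opprK rmorphB rmorph1 rmorphXn; field.
apply: (@cvg_series_unshift (fun n => moebius_coef a n * w ^+ n)).
rewrite [X in X @ _ --> _](_ : _ = (fun n => (1 - a ^+ 2)%:C * w *
    series (fun n => (- (a%:C * w)) ^+ n) n)).
  by apply: cvgMr; exact (geometric_series z1).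
apply/funext => n; rewrite /series/= big_distrr/=; apply: eq_bigr => i _.
have -> : - (a%:C * w) = (- a)%:C * w by rewrite rmorphN mulNr.
have -> : ((- a)%:C * w) ^+ i = ((- a) ^+ i)%:C * w ^+ i.
  by rewrite exprMn rmorphXn.
rewrite /= [w ^+ i.+1]exprS.
by move: (w ^+ i) (((- a) ^+ i)%:C) ((1 - a ^+ 2)%:C) => W A B; ring.
Qed.

Lemma moebius_lt1 (a : R) w : 0 <= a < 1 -> modulus w < 1 ->
  modulus ((a%:C + w) / (1 + a%:C * w)) < 1.
Proof.
move=> a01 w1; have /andP[a0 a1] := a01.
have := moebius_den_neq0 a01 w1; rewrite -modulus_gt0 => den.
rewrite modulusM modulusV ltr_pdivrMr// mul1r.
rewrite -(ltr_pXn2r (n := 2)) ?nnegrE ?modulus_ge0// -subr_gt0.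
have := @moebius_identity R (- a)%:C w.
rewrite conjc_real rmorphN mulNr opprK opprK modulusN modulus_real ger0_norm//.
rewrite (addrC w) => ->.
by rewrite mulr_gt0// subr_gt0 exprn_ilt1 ?modulus_ge0.
Qed.

End Extremal.

Section Sharpness.
Variable R : realType.

(** Multinomial expansion: expanding the product of [n] equal sums gives one
    term per map [f] from the [n] factors to the [d] coordinates, and the
    terms are grouped according to the sizes of the fibres of [f]. *)
Lemma homogeneous_linear_power d n (s : cplx R) (l : 'I_d -> cplx R) :
  homogeneous_poly n (fun z => s * (\sum_i z 0 i * l i) ^+ n).
Proof.
(* The multi-index of the monomial selected by [f]. *)
pose mult (f : {ffun 'I_n -> 'I_d}) : {ffun 'I_d -> 'I_n.+1} :=
  [ffun i => inord #|[pred j | f j == i]|].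
have multE f i : mult f i = #|[pred j | f j == i]| :> nat.
  by rewrite ffunE inordK// ltnS -[leqRHS]card_ord max_card.
have mult_weight f : (\sum_i mult f i == n)%N.
  under eq_bigr do rewrite multE -sum1_card.
  rewrite -[X in _ == X]card_ord -sum1_card; apply/eqP.
  by rewrite [RHS](partition_big f xpredT)//=; apply: eq_bigr => i _.
exists (fun al => s * \sum_(f | mult f == al) \prod_j l (f j)) => z.
have -> : (\sum_i z 0 i * l i) ^+ n = \prod_(j < n) \sum_i z 0 i * l i.
  by rewrite prodr_const card_ord.
rewrite bigA_distr_bigA/=.
rewrite (partition_big mult (fun al => (\sum_i al i == n)%N)) => [|f _]; last first.
  exact: mult_weight.
rewrite big_distrr/=; apply: eq_bigr => al _; rewrite -mulrA; congr (_ * _).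
rewrite big_distrl/=; apply: eq_bigr => f /eqP <-.
rewrite big_split/= mulrC; congr (_ * _).
rewrite (partition_big f xpredT)//=; apply: eq_bigr => i _.
rewrite multE -prodr_const; apply: eq_big => [j|j /eqP ->//].
by rewrite inE.
Qed.

Lemma differentiable_linear_form d (l : 'I_d -> cplx R) (z : 'rV[cplx R]_d) :
  differentiable (fun z : 'rV[cplx R]_d => \sum_i z 0 i * l i) z.
Proof.
have -> : (fun z : 'rV[cplx R]_d => \sum_i z 0 i * l i) =
    \sum_(i < d) (fun z : 'rV[cplx R]_d => z 0 i * l i).
  by apply/funext => x; rewrite fct_sumE.
apply: differentiable_sum => i.
apply: (@differentiableM _ _ (fun z : 'rV[cplx R]_d => z 0 i) (cst (l i))).
  exact: differentiable_coord.
exact: differentiable_cst.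
Qed.

Lemma admissible_moebius d (Q : set 'rV[cplx R]_d) (l : 'I_d -> cplx R) (a : R) :
  0 <= a < 1 -> (forall x, Q x -> modulus (\sum_i x 0 i * l i) < 1) ->
  admissible Q (fun z => (a%:C + \sum_i z 0 i * l i) / (1 + a%:C * \sum_i z 0 i * l i))
    (fun n z => moebius_coef a n * (\sum_i z 0 i * l i) ^+ n).
Proof.
move=> a01 lQ; split.
- move=> z Qz; have dl := differentiable_linear_form l z.
  pose num (z : 'rV[cplx R]_d) : cplx R := a%:C + \sum_i z 0 i * l i.
  pose den (z : 'rV[cplx R]_d) : cplx R := 1 + a%:C * \sum_i z 0 i * l i.
  have dnum : differentiable num z.
    exact (differentiableD (differentiable_cst _ _) dl).
  have dden : differentiable den z.
    apply: (differentiableD (differentiable_cst _ _)).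
    exact (differentiableM (differentiable_cst _ _) dl).
  apply: (differentiableM dnum); apply: (differentiableV dden).
  exact: (moebius_den_neq0 a01 (lQ z Qz)).
- split; first by move=> n; exact: homogeneous_linear_power.
  by move=> z Qz; exact (moebius_series a01 (lQ z Qz)).
- rewrite (_ : \sum_i _ = 0); last first.
    by rewrite big1// => i _; rewrite mxE mul0r.
  by apply: moebius_lt1; rewrite ?modulus0.
- by move=> z Qz; apply: moebius_lt1 => //; exact: lQ.
Qed.

(** Passage to the limit in the partial sums of a geometric series. *)
Lemma le_of_geometric_partial (X B q : R) : 0 <= B -> 0 <= q < 1 ->
  (forall M, X + B * (1 - q ^+ M) <= 1) -> X + B <= 1.
Proof.
move=> B0 /andP[q0 q1] H; apply/ler_addgt0Pr => e e0.
have /cvgrPdist_lt/(_ (e / (B + 1))) : geometric 1 q @ \oo --> 0.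
  by apply: cvg_geometric; rewrite ger0_norm.
have B1 : 0 < B + 1 by rewrite ltr_wpDl.
case; first by rewrite divr_gt0.
move=> M _ /(_ M (leqnn _)); rewrite /geometric/= mul1r sub0r normrN.
rewrite ger0_norm ?exprn_ge0// ltr_pdivlMr// => qM.
by have := H M; have := exprn_ge0 M q0; nra.
Qed.

(** At [a = 1] the inequality is [0 < radius_poly k m N p r]; by continuity it
    persists for [a] slightly below 1. *)
Lemma extremal_parameter k m N (p r : R) : 0 < r < 1 ->
  0 < radius_poly k m N p r ->
  exists2 a : R, 0 < a < 1 &
    p * (1 - r ^+ m) * (1 - a * r ^+ k) <
    (1 + a) * a ^+ N.-1 * r ^+ (k * N) * (a + r ^+ m).
Proof.
move=> r01 phi.
pose psi (a : R) := (1 + a) * a ^+ N.-1 * r ^+ (k * N) * (a + r ^+ m) -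
  p * (1 - r ^+ m) * (1 - a * r ^+ k).
have psi1 : 0 < psi 1.
  rewrite /psi expr1n !mul1r mulr1; move: phi; rewrite /radius_poly.
  by rewrite (_ : 1 + 1 = 2 :> R)//; lra.
have cpsi : {for 1, continuous psi}.
  apply: cvgB.
    apply: cvgM; last by apply: cvgD; [exact: cvg_id|exact: cvg_cst].
    apply: cvgM; last exact: cvg_cst.
    apply: cvgM; last exact: exprn_continuous.
    by apply: cvgD; [exact: cvg_cst|exact: cvg_id].
  apply: cvgM; first exact: cvg_cst.
  apply: cvgB; first exact: cvg_cst.
  by apply: cvgM; [exact: cvg_id|exact: cvg_cst].
have /nbhs_ballP [e /= e0 He] : nbhs (1 : R) [set a | 0 < psi a].
  exact (cpsi _ (lt_nbhsr psi1)).
pose t := Num.min (e / 2) (1 / 2).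
have t0 : 0 < t by rewrite lt_min !divr_gt0.
have te : t < e by rewrite gt_min; apply/orP; left; lra.
have t1 : t < 1 by rewrite gt_min; apply/orP; right; lra.
exists (1 - t); first by apply/andP; split; lra.
rewrite -subr_gt0; apply: (He (1 - t)).
by rewrite -ball_normE /= subKr gtr0_norm.
Qed.

(** Substitutes the lower bound of [powR_ge_tangent], which is exact to first
    order as [a] tends to 1, and clears the common factor [1 - a]. *)
Lemma extremal_real_inequality k m N (p r a : R) : (0 < N)%N -> 0 < p ->
  0 < r < 1 -> (0 < k)%N -> 0 < a < 1 ->
  p * (1 - r ^+ m) * (1 - a * r ^+ k) <
    (1 + a) * a ^+ N.-1 * r ^+ (k * N) * (a + r ^+ m) ->
  1 < ((a + r ^+ m) / (1 + a * r ^+ m)) `^ p +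
    (1 - a ^+ 2) * a ^+ N.-1 * r ^+ (k * N) / (1 - a * r ^+ k).
Proof.
move=> N0 p0 /andP[r0 r1] k0 /andP[a0 a1] psi.
have rho0 : 0 < r ^+ m by rewrite exprn_gt0.
have rk1 : r ^+ k < 1 by rewrite exprn_ilt1 ?ltW// -lt0n.
have rk0 : 0 < r ^+ k by rewrite exprn_gt0.
have T0 : 0 < r ^+ (k * N) by rewrite exprn_gt0.
have aN0 : 0 < a ^+ N.-1 by rewrite exprn_gt0.
move: (r ^+ m) (r ^+ k) (r ^+ (k * N)) (a ^+ N.-1) rho0 rk1 rk0 T0 aN0 psi.
move=> rho t T A rho0 t1 t0 T0 A0 psi.
have d1 : 0 < 1 + a * rho by rewrite addr_gt0// mulr_gt0.
have n1 : 0 < a + rho by rewrite addr_gt0.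
have d2 : 0 < 1 - a * t by rewrite subr_gt0; nra.
set x := (a + rho) / _; have x0 : 0 < x by rewrite divr_gt0.
apply: lt_le_trans (lerD (powR_ge_tangent x0 p0) (lexx _)).
have -> : p * (1 - x) / x = p * (1 - rho) * (1 - a) / (a + rho).
  by rewrite /x; field; rewrite !gt_eqF.
suff : p * (1 - rho) * (1 - a) / (a + rho) < (1 - a ^+ 2) * A * T / (1 - a * t) by lra.
rewrite ltr_pdivrMr// [ltRHS]mulrAC ltr_pdivlMr//.
have -> : p * (1 - rho) * (1 - a) * (1 - a * t) = (1 - a) * (p * (1 - rho) * (1 - a * t)) by ring.
have -> : (1 - a ^+ 2) * A * T * (a + rho) = (1 - a) * ((1 + a) * A * T * (a + rho)) by ring.
by rewrite ltr_pM2l// subr_gt0.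
Qed.

(** The inequality is tested at [h = r] real, strictly between [r0] and [r'],
    where all the terms of the extremal functions are explicit. *)
Lemma bohr_radius_sharp d k m N (p r0 r' : R) (Q : set 'rV[cplx R]_d) :
  (0 < k)%N -> (0 < m)%N -> (0 < N)%N -> 0 < p ->
  radius_root k m N p r0 -> r0 < r' <= 1 ->
  complete_circular_domain Q -> convex_set Q -> Q <> setT ->
  exists f P w1 w2, [/\ admissible Q f P, class_Bk m w1, class_Bk k w2
    & ~ bohr_ineq_in N p r' Q f P w1 w2].
Proof.
move=> k0 m0 N0 p0 [/andP[r00 r01] root0] /andP[r0r' r'1] hQ cQ QT.
have [l [b [lQ lb bQ]]] := supporting_functional hQ cQ QT.
(* Only [r0 < r < r'] matters; in particular [r < 1] even when [r' = 1]. *)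
pose r := (r0 + r') / 2.
have r_gt : r0 < r by rewrite /r; lra.
have r_lt : r < r' by rewrite /r; lra.
have r1 : r < 1 by lra.
have rr : 0 < r by lra.
have rr01 : 0 < r < 1 by rewrite rr.
clearbody r.
have phi : 0 < radius_poly k m N p r.
  by rewrite -root0; apply: radius_poly_mono => //; exact: ltW.
have [a a01 psi] := extremal_parameter rr01 phi.
have /andP[a0 a1] := a01; have a01' : 0 <= a < 1 by rewrite (ltW a0).
pose f (z : 'rV[cplx R]_d) := (a%:C + \sum_i z 0 i * l i) / (1 + a%:C * \sum_i z 0 i * l i).
pose P n (z : 'rV[cplx R]_d) := moebius_coef a n * (\sum_i z 0 i * l i) ^+ n.
exists f, P, (fun h => h ^+ m), (fun h => h ^+ k); split.
- exact: admissible_moebius.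
- exact: class_Bk_monomial.
- exact: class_Bk_monomial.
move=> /(_ b bQ r%:C); have rm : modulus (r%:C : cplx R) = r.
  by rewrite modulus_real gtr0_norm.
rewrite /unit_disc /mkset rm => /(_ r1 r_lt); rewrite /bohr_ineq.
have lb' c : \sum_i (c *: b) 0 i * l i = c.
  under eq_bigr do rewrite mxE -mulrA.
  by rewrite -big_distrr/= lb mulr1.
have fE : modulus (f ((r%:C : cplx R) ^+ m *: b)) = (a + r ^+ m) / (1 + a * r ^+ m).
  rewrite /f lb'.
  have -> : (a%:C + (r%:C : cplx R) ^+ m) / (1 + a%:C * (r%:C) ^+ m) =
      ((a + r ^+ m) / (1 + a * r ^+ m))%:C.
    have -> : (r%:C : cplx R) ^+ m = (r ^+ m)%:C by rewrite rmorphXn.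
    by move: (r ^+ m) => rho; rewrite rmorphM fmorphV !rmorphD rmorphM rmorph1.
  rewrite modulus_real ger0_norm// divr_ge0// addr_ge0 ?mulr_ge0 ?exprn_ge0//; exact: ltW.
rewrite fE modulusX rm.
set X := _ `^ p; set u := fun n => _.
move=> H; have := extremal_real_inequality N0 p0 rr01 k0 a01 psi.
rewrite -/X ltNge => /negP; apply.
have a2 : 0 <= 1 - a ^+ 2 by rewrite subr_ge0 exprn_ile1// ltW.
have at0 : 0 <= a * r ^+ k by rewrite mulr_ge0 ?exprn_ge0// ltW.
have at1 : a * r ^+ k < 1.
  by rewrite (le_lt_trans _ a1)// ler_piMr ?(ltW a0)// exprn_ile1 ?ltW.
have at1' : 0 < 1 - a * r ^+ k by rewrite subr_gt0.
apply: (@le_of_geometric_partial _ _ (a * r ^+ k)).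
- by rewrite !mulr_ge0 ?exprn_ge0 ?invr_ge0 ?(ltW at1')// ltW.
- by rewrite at0.
move=> M; rewrite -lee_fin EFinD; apply: le_trans H; apply: leeD => //.
pose v n := modulus (P n b) * (r ^+ k) ^+ n.
have v0 n : 0 <= v n by rewrite mulr_ge0 ?modulus_ge0// !exprn_ge0// ltW.
apply: le_trans (partial_sum_le_nneseries N (M + N) v0); rewrite lee_fin.
have -> : \sum_(N <= i < M + N) v i = \sum_(0 <= i < M) v (i + N)%N.
  by rewrite -{1}[N]add0n big_addn addnK.
have vE i : v (i + N)%N = (1 - a ^+ 2) * a ^+ N.-1 * r ^+ (k * N) * (a * r ^+ k) ^+ i.
  have iN : (i + N)%N = (i + N.-1).+1 by rewrite -addnS prednK.
  rewrite /v /P lb expr1n mulr1 {1}iN modulus_moebius_coef//.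
  by rewrite [(a * _) ^+ i]exprMn exprM !exprD; ring.
under eq_bigr do rewrite vE.
rewrite -big_distrr/= -[leLHS]mulrA ler_wpM2l//.
  by rewrite !mulr_ge0 ?exprn_ge0// ltW.
by rewrite mulrC ler_pdivrMr// [leRHS]mulrC geometric_sum.
Qed.

End Sharpness.

Unset Implicit Arguments.
Local Close Scope complex_scope.

(** * The Bohr radius *)

Theorem theorem2p3 (R : realType) (d k m0 N : nat) (p : R)
    (Q : set 'rV[cplx R]_d)
    (hd : (0 < d)%N) (hk : (0 < k)%N) (hm0 : (0 < m0)%N) (hN : (0 < N)%N)
    (hp : 0 < p <= 2) (hQ : complete_circular_domain Q) :
  exists r0 : R, min_radius_root k m0 N p r0 /\
    (forall (f : 'rV[cplx R]_d -> cplx R) (P : nat -> 'rV[cplx R]_d -> cplx R)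
            (w1 w2 : cplx R -> cplx R),
        admissible Q f P -> class_Bk m0 w1 -> class_Bk k w2 ->
        bohr_ineq_in N p r0 Q f P w1 w2) /\
    (convex_set Q -> Q <> setT ->
     forall r' : R, r0 < r' <= 1 ->
     exists (f : 'rV[cplx R]_d -> cplx R) (P : nat -> 'rV[cplx R]_d -> cplx R)
            (w1 w2 : cplx R -> cplx R),
       [/\ admissible Q f P, class_Bk m0 w1, class_Bk k w2
         & ~ bohr_ineq_in N p r' Q f P w1 w2]).
Proof.
have p0 : 0 < p by case/andP: hp.
have [r0 [root0 min0]] := @min_radius_root_exists R k m0 N p hk hm0 hN p0.
exists r0; split; first by split.
split.
  move=> f P w1 w2 fP w1B w2B.
  exact: (bohr_inequality_slice hk hm0 hN hp root0 fP w1B w2B).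
move=> cQ QT r' r0r'; exact: (bohr_radius_sharp hk hm0 hN p0 root0).
Qed.
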